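(* There is an effective procedure which assigns to each $\Sigma_1$-sentence $\sigma$ of $\mathbb{L}_{\sf a}$ an $\mathbb{L}_{\sf ap}$-sentence $[\sigma]_{\sf p}$ such that: (1) $[\sigma]_{\sf p} \vdash \sigma$; (2) if $\mathbb{N}\models\sigma$, then $\mathsf{R}_{0\mathsf{p}} \vdash [\sigma]_{\sf p}$; (3) if $\mathbb{N}\models\neg\sigma$, then $[\sigma]_{\sf p} \vdash \mathsf{R}_{0\mathsf{p}}$.
   Context: $\mathbb{L}_{\sf a}$ is the signature $\{0,\mathsf{S},+,\times,\leq\}$ with $\leq$ primitive; $\overline{n}$ is the $n$-th numeral. $\mathsf{R}_0$ is the $\mathbb{L}_{\sf a}$-theory with axioms, for all $m,n\in\omega$: $\overline{m}+\overline{n}=\overline{m+n}$; $\overline{m}\times\overline{n}=\overline{m\times n}$; $\overline{m}\neq\overline{n}$ if $m\neq n$; $\forall x\,(x\leq\overline{n}\to\bigvee_{i\leq n}x=\overline{i})$; $\overline{m}\leq\overline{n}$ if $m\leq n$. $\mathbb{L}_{\sf ap}$ is $\mathbb{L}_{\sf a}$ extended by a unary predicate symbol $\mathsf{P}$, and $\mathsf{R}_{0\mathsf{p}}$ is the $\mathbb{L}_{\sf ap}$-theory $\mathsf{R}_0$ plus the axioms $\mathsf{P}(\overline{n})$ for all $n\in\omega$. A $\Sigma_1$-sentence is one of the form $\exists\vec{x}\,\delta$ with $\delta$ bounded. *)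

(* Defs.v *)
From Stdlib Require List.
From mathcomp Require Import all_boot.

Set Implicit Arguments.
Unset Strict Implicit.
Unset Printing Implicit Defensive.

(* Syntax, with de Bruijn indices: [tvar 0] is bound by the innermost
   enclosing quantifier. *)

Inductive term : Type :=
| tvar of nat
| tzero
| tsucc of term
| tadd of term & term
| tmul of term & term.

(* [p] records whether the unary predicate symbol P is in the signature:
   [fP] takes a proof of [p], so it cannot occur in a [form false]. *)
Inductive form (p : bool) : Type :=
| fbot
| feq of term & term
| fle of term & term
| fP of p & term
| fimp of form p & form p
| fand of form p & form p
| for_ of form p & form p
| fall of form p
| fex of form p.

Arguments fbot {p}.
Arguments feq {p}.
Arguments fle {p}.

Definition La := form false.
Definition Lap := form true.

Definition fneg p (f : form p) : form p := fimp f fbot.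

Fixpoint emb (f : La) : Lap :=
  match f with
  | fbot => fbot
  | feq t s => feq t s
  | fle t s => fle t s
  | fP h _ => match notF h with end
  | fimp f g => fimp (emb f) (emb g)
  | fand f g => fand (emb f) (emb g)
  | for_ f g => for_ (emb f) (emb g)
  | fall f => fall (emb f)
  | fex f => fex (emb f)
  end.

Fixpoint tsubst (s : nat -> term) (t : term) : term :=
  match t with
  | tvar n => s n
  | tzero => tzero
  | tsucc t => tsucc (tsubst s t)
  | tadd t u => tadd (tsubst s t) (tsubst s u)
  | tmul t u => tmul (tsubst s t) (tsubst s u)
  end.

Definition scons T (x : T) (s : nat -> T) (n : nat) : T :=
  if n is m.+1 then s m else x.

Definition tshift (t : term) : term := tsubst (fun n => tvar n.+1) t.

Definition sup (s : nat -> term) : nat -> term :=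
  scons (tvar 0) (fun n => tshift (s n)).

Fixpoint fsubst p (s : nat -> term) (f : form p) : form p :=
  match f with
  | fbot => fbot
  | feq t u => feq (tsubst s t) (tsubst s u)
  | fle t u => fle (tsubst s t) (tsubst s u)
  | fP h t => fP h (tsubst s t)
  | fimp f g => fimp (fsubst s f) (fsubst s g)
  | fand f g => fand (fsubst s f) (fsubst s g)
  | for_ f g => for_ (fsubst s f) (fsubst s g)
  | fall f => fall (fsubst (sup s) f)
  | fex f => fex (fsubst (sup s) f)
  end.

Definition fshift p (f : form p) : form p := fsubst (fun n => tvar n.+1) f.

Definition finst p (t : term) (f : form p) : form p := fsubst (scons t tvar) f.

Fixpoint tclosed (k : nat) (t : term) : bool :=
  match t with
  | tvar n => n < k
  | tzero => true
  | tsucc t => tclosed k t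
  | tadd t u => tclosed k t && tclosed k u
  | tmul t u => tclosed k t && tclosed k u
  end.

(* All free variables of [f] have index below [k]. *)
Fixpoint fclosed p (k : nat) (f : form p) : bool :=
  match f with
  | fbot => true
  | feq t u => tclosed k t && tclosed k u
  | fle t u => tclosed k t && tclosed k u
  | fP _ t => tclosed k t
  | fimp f g => fclosed k f && fclosed k g
  | fand f g => fclosed k f && fclosed k g
  | for_ f g => fclosed k f && fclosed k g
  | fall f => fclosed k.+1 f
  | fex f => fclosed k.+1 f
  end.

Definition sentence p (f : form p) : bool := fclosed 0 f.

(* In bounded quantifiers the bound [t] does not contain the quantified
   variable, whence the shift. *)
Inductive bounded : La -> Prop :=
| bounded_bot : bounded fbot
| bounded_eq t u : bounded (feq t u)
| bounded_le t u : bounded (fle t u)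
| bounded_imp f g : bounded f -> bounded g -> bounded (fimp f g)
| bounded_and f g : bounded f -> bounded g -> bounded (fand f g)
| bounded_or f g : bounded f -> bounded g -> bounded (for_ f g)
| bounded_all t f :
    bounded f -> bounded (fall (fimp (fle (tvar 0) (tshift t)) f))
| bounded_ex t f :
    bounded f -> bounded (fex (fand (fle (tvar 0) (tshift t)) f)).

Definition Sigma1_sentence (f : La) : Prop :=
  sentence f /\ exists k d, bounded d /\ f = iter k (@fex false) d.

(* Natural deduction for classical first-order logic with equality. *)
Inductive prv p : seq (form p) -> form p -> Prop :=
| prv_ax G f : List.In f G -> prv G f
| prv_raa G f : prv (fneg f :: G) fbot -> prv G f
| prv_impI G f g : prv (f :: G) g -> prv G (fimp f g)
| prv_impE G f g : prv G (fimp f g) -> prv G f -> prv G g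
| prv_andI G f g : prv G f -> prv G g -> prv G (fand f g)
| prv_andE1 G f g : prv G (fand f g) -> prv G f
| prv_andE2 G f g : prv G (fand f g) -> prv G g
| prv_orI1 G f g : prv G f -> prv G (for_ f g)
| prv_orI2 G f g : prv G g -> prv G (for_ f g)
| prv_orE G f g h :
    prv G (for_ f g) -> prv (f :: G) h -> prv (g :: G) h -> prv G h
| prv_allI G f : prv (map (@fshift p) G) f -> prv G (fall f)
| prv_allE G f t : prv G (fall f) -> prv G (finst t f)
| prv_exI G f t : prv G (finst t f) -> prv G (fex f)
| prv_exE G f g :
    prv G (fex f) -> prv (f :: map (@fshift p) G) (fshift g) -> prv G g
| prv_eqI G t : prv G (feq t t)
| prv_eqE G f t u : prv G (feq t u) -> prv G (finst t f) -> prv G (finst u f).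

Definition theory p := form p -> Prop.

Definition proves p (T : theory p) (f : form p) : Prop :=
  exists2 G, (forall g, List.In g G -> T g) & prv G f.

Definition proves_theory p (T U : theory p) : Prop :=
  forall f, U f -> proves T f.

Definition axiomatized_by p (f : form p) : theory p := fun g => g = f.

Fixpoint num (n : nat) : term := if n is m.+1 then tsucc (num m) else tzero.

(* The disjunction of [t = num i] for [i <= n]. *)
Fixpoint one_of_upto (t : term) (n : nat) : La :=
  if n is m.+1 then for_ (one_of_upto t m) (feq t (num n)) else feq t (num 0).

Inductive R0 : theory false :=
| R0_add m n : R0 (feq (tadd (num m) (num n)) (num (m + n)))
| R0_mul m n : R0 (feq (tmul (num m) (num n)) (num (m * n)))
| R0_neq m n : m <> n -> R0 (fneg (feq (num m) (num n)))
| R0_bound n :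
    R0 (fall (fimp (fle (tvar 0) (num n)) (one_of_upto (tvar 0) n)))
| R0_le m n : m <= n -> R0 (fle (num m) (num n)).

Inductive R0p : theory true :=
| R0p_R0 f : R0 f -> R0p (emb f)
| R0p_P n : R0p (fP isT (num n)).

Fixpoint teval (e : nat -> nat) (t : term) : nat :=
  match t with
  | tvar n => e n
  | tzero => 0
  | tsucc t => (teval e t).+1
  | tadd t u => teval e t + teval e u
  | tmul t u => teval e t * teval e u
  end.

Fixpoint nat_sat (e : nat -> nat) (f : La) : Prop :=
  match f with
  | fbot => False
  | feq t u => teval e t = teval e u
  | fle t u => teval e t <= teval e u
  | fP h _ => match notF h with end
  | fimp f g => nat_sat e f -> nat_sat e g
  | fand f g => nat_sat e f /\ nat_sat e g
  | for_ f g => nat_sat e f \/ nat_sat e g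
  | fall f => forall n, nat_sat (scons n e) f
  | fex f => exists n, nat_sat (scons n e) f
  end.

Definition nat_models (f : La) : Prop := forall e, nat_sat e f.

(* Total recursive functions: the least class containing the initial functions
   and closed under composition, primitive recursion, and minimization of
   functions that have a zero for all parameters.  Defining equations are
   pointwise, so the class is closed under extensional equality. *)
Inductive recursive : forall k, (k.-tuple nat -> nat) -> Prop :=
| rec_zero k (f : k.-tuple nat -> nat) : (forall v, f v = 0) -> recursive f
| rec_succ (f : 1.-tuple nat -> nat) :
    (forall n, f [tuple n] = n.+1) -> recursive f
| rec_proj k (i : 'I_k) (f : k.-tuple nat -> nat) :
    (forall v, f v = tnth v i) -> recursive f
| rec_comp k m (g : m.-tuple nat -> nat) (h : 'I_m -> k.-tuple nat -> nat)
    (f : k.-tuple nat -> nat) :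
    recursive g -> (forall i, recursive (h i)) ->
    (forall v, f v = g [tuple h i v | i < m]) -> recursive f
| rec_prec k (g : k.-tuple nat -> nat) (h : k.+2.-tuple nat -> nat)
    (f : k.+1.-tuple nat -> nat) :
    recursive g -> recursive h ->
    (forall v : k.-tuple nat, f [tuple of 0 :: v] = g v) ->
    (forall n (v : k.-tuple nat),
       f [tuple of n.+1 :: v] = h [tuple of n :: f [tuple of n :: v] :: v]) ->
    recursive f
| rec_min k (g : k.+1.-tuple nat -> nat) (f : k.-tuple nat -> nat) :
    recursive g ->
    (forall v : k.-tuple nat, g [tuple of f v :: v] = 0) ->
    (forall (v : k.-tuple nat) n, n < f v -> g [tuple of n :: v] <> 0) ->
    recursive f.

(* Cantor's pairing function (a + b)(a + b + 1) / 2 + b. *)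
Definition cpair (a b : nat) : nat := 'C((a + b).+1, 2) + b.

Fixpoint tgn (t : term) : nat :=
  match t with
  | tvar n => cpair 0 n
  | tzero => cpair 1 0
  | tsucc t => cpair 2 (tgn t)
  | tadd t u => cpair 3 (cpair (tgn t) (tgn u))
  | tmul t u => cpair 4 (cpair (tgn t) (tgn u))
  end.

Fixpoint fgn p (f : form p) : nat :=
  match f with
  | fbot => cpair 0 0
  | feq t u => cpair 1 (cpair (tgn t) (tgn u))
  | fle t u => cpair 2 (cpair (tgn t) (tgn u))
  | fP _ t => cpair 3 (tgn t)
  | fimp f g => cpair 4 (cpair (fgn f) (fgn g))
  | fand f g => cpair 5 (cpair (fgn f) (fgn g))
  | for_ f g => cpair 6 (cpair (fgn f) (fgn g))
  | fall f => cpair 7 (fgn f)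
  | fex f => cpair 8 (fgn f)
  end.

Lemma cpair_inj a b c d : cpair a b = cpair c d -> a = c /\ b = d.
Proof.
have mono x y u v : x + y < u + v -> cpair x y < cpair u v.
  move=> lt; rewrite /cpair; apply: (@leq_trans 'C((x + y).+2, 2)).
    by rewrite [in X in _ < X]binS bin1 ltn_add2l ltnS leq_addl.
  by apply: leq_trans (leq_addr _ _); rewrite leq_bin2l.
move=> e; have E : a + b = c + d.
  by case: (ltngtP (a + b) (c + d)) => // /mono; rewrite e ltnn.
move: e; rewrite /cpair E => /addnI eb.
by move: E; rewrite eb => /addIn.
Qed.

Lemma tgn_inj : injective tgn.
Proof.
by elim=> [n||t IH|t IH u IHu|t IH u IHu] [m||t'|t' u'|t' u'] /=;
  case/cpair_inj=> // _; [move-> | move/IH-> |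
    case/cpair_inj=> /IH-> /IHu-> | case/cpair_inj=> /IH-> /IHu->].
Qed.

Lemma fgn_inj p : injective (@fgn p).
Proof.
elim=> [|t u|t u|h t|f IHf g IHg|f IHf g IHg|f IHf g IHg|f IHf|f IHf]
  [|t' u'|t' u'|h' t'|f' g'|f' g'|f' g'|f'|f'] //= /cpair_inj[] // _.
- by case/cpair_inj=> /tgn_inj-> /tgn_inj->.
- by case/cpair_inj=> /tgn_inj-> /tgn_inj->.
- by move/tgn_inj->; rewrite (bool_irrelevance h h').
- by case/cpair_inj=> /IHf-> /IHg->.
- by case/cpair_inj=> /IHf-> /IHg->.
- by case/cpair_inj=> /IHf-> /IHg->.
- by move/IHf->.
- by move/IHf->.
Qed.

(* [tr], restricted to the formulas in [D], is computed on Goedel numbers by a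
   recursive function. *)
Definition effective_on p q (D : form p -> Prop) (tr : form p -> form q) : Prop :=
  exists2 F : 1.-tuple nat -> nat, recursive F
    & forall f, D f -> F [tuple fgn f] = fgn (tr f).

(* Main.v *)
From Stdlib Require Import List Classical ClassicalEpsilon.
From Stdlib Require Import FunctionalExtensionality PropExtensionality ProofIrrelevance.
From mathcomp Require Import all_boot zify.
Require Import Defs.

Set Implicit Arguments.
Unset Strict Implicit.
Unset Printing Implicit Defensive.

(** Let sigma be [exists x, delta x] and let c be its Goedel number.  The
    translation is the conjunction of sigma with the sentence saying that delta
    has witnesses x_i <= z for some z >= 2, and that there is a w such that P
    and the basic laws of arithmetic are correct up to w, and
    z^(2^k) <= w for all k <= c.  The tower is so high that all values of terms
    met in evaluating delta at arguments below z stay below w.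
    If sigma is true, numerals for z and w can be found and R_0p verifies
    everything about them.  If sigma is false, then in a model of the translation
    w cannot be a standard number, since delta would be evaluated correctly; so
    all standard numbers are below w, which gives the axioms of R_0p.
    Goedel's completeness theorem turns these arguments about models into
    derivations.  The translation is effective because it never looks inside
    delta: only the leading existential quantifiers are removed, and then c
    quantifiers, some of them possibly vacuous, are put back. *)

(** * Substitution *)

Lemma tsubst_closed k t s r :
  (forall n, n < k -> s n = r n) -> tclosed k t -> tsubst s t = tsubst r t.
Proof.
move=> E; elim: t => //= [t IH|t IH u IHu|t IH u IHu].
- by move=> /IH->.
- by case/andP=> /IH-> /IHu->.
- by case/andP=> /IH-> /IHu->.
Qed.

Lemma fsubst_closed p (f : form p) k s r :
  (forall n, n < k -> s n = r n) -> fclosed k f -> fsubst s f = fsubst r f.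
Proof.
elim: f k s r => //= [t u|t u|h t|f IHf g IHg|f IHf g IHg|f IHf g IHg|f IHf|f IHf]
  k s r E.
1,2: by case/andP=> /(tsubst_closed E)-> /(tsubst_closed E)->.
1: by move=> /(tsubst_closed E)->.
1-3: by case/andP=> /(IHf _ _ _ E)-> /(IHg _ _ _ E)->.
all: move=> cl; rewrite (IHf _ (sup s) (sup r) _ cl) // => -[|n] //= lt.
all: by rewrite E.
Qed.

Lemma eq_tsubst s r t : s =1 r -> tsubst s t = tsubst r t.
Proof. by move=> E; elim: t => //= [t ->|t -> u ->|t -> u ->]. Qed.

Lemma eq_sup s r : s =1 r -> sup s =1 sup r.
Proof. by move=> E [|n] //=; rewrite E. Qed.

Lemma eq_fsubst p (f : form p) s r : s =1 r -> fsubst s f = fsubst r f.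
Proof.
elim: f s r => //= [t u|t u|h t|f IHf g IHg|f IHf g IHg|f IHf g IHg|f IHf|f IHf]
  s r E.
1-3: by rewrite !(eq_tsubst _ E).
1-3: by rewrite (IHf _ _ E) (IHg _ _ E).
all: by rewrite (IHf _ _ (eq_sup E)).
Qed.

Lemma tsubst_comp s r t : tsubst s (tsubst r t) = tsubst (tsubst s \o r) t.
Proof. by elim: t => //= [t ->|t -> u ->|t -> u ->]. Qed.

Lemma sup_comp s r : tsubst (sup s) \o sup r =1 sup (tsubst s \o r).
Proof. by case=> [|n] //=; rewrite /tshift !tsubst_comp; apply: eq_tsubst. Qed.

Lemma fsubst_comp p (f : form p) s r :
  fsubst s (fsubst r f) = fsubst (tsubst s \o r) f.
Proof.
elim: f s r => //= [t u|t u|h t|f IHf g IHg|f IHf g IHg|f IHf g IHg|f IHf|f IHf]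
  s r; rewrite ?tsubst_comp ?IHf ?IHg //.
all: by rewrite (eq_fsubst _ (sup_comp s r)).
Qed.

Lemma tsubst_id t : tsubst tvar t = t.
Proof. by elim: t => //= [t ->|t -> u ->|t -> u ->]. Qed.

Lemma fsubst_id p (f : form p) : fsubst tvar f = f.
Proof.
have E : sup tvar =1 tvar by case.
elim: f => //= [t u|t u|h t|f IHf g IHg|f IHf g IHg|f IHf g IHg|f IHf|f IHf];
  by rewrite ?tsubst_id ?(eq_fsubst _ E) ?IHf ?IHg.
Qed.

Lemma fsubst_shift p (f : form p) s : fsubst (sup s) (fshift f) = fshift (fsubst s f).
Proof. by rewrite /fshift !fsubst_comp; apply: eq_fsubst. Qed.

Lemma fsubst_inst p (f : form p) s t :
  fsubst s (finst t f) = finst (tsubst s t) (fsubst (sup s) f).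
Proof.
rewrite /finst !fsubst_comp; apply: eq_fsubst => -[|n] //=.
by rewrite /tshift tsubst_comp -[LHS]tsubst_id; apply: eq_tsubst.
Qed.

Lemma finst_sup p (f : form p) s t : finst t (fsubst (sup s) f) = fsubst (scons t s) f.
Proof.
rewrite /finst fsubst_comp; apply: eq_fsubst => -[|n] //=.
by rewrite /tshift tsubst_comp -[RHS]tsubst_id; apply: eq_tsubst.
Qed.

Lemma tclosed_mono k m t : k <= m -> tclosed k t -> tclosed m t.
Proof.
move=> le; elim: t => //= [n lt|t IH u IHu|t IH u IHu]; first exact: leq_trans le.
all: by case/andP=> /IH-> /IHu->.
Qed.

Lemma fclosed_mono p (f : form p) k m : k <= m -> fclosed k f -> fclosed m f.
Proof.
elim: f k m => //= [t u|t u|h t|f IHf g IHg|f IHf g IHg|f IHf g IHg|f IHf|f IHf]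
  k m le.
1,2: by case/andP=> /(tclosed_mono le)-> /(tclosed_mono le)->.
1: exact: tclosed_mono.
1-3: by case/andP=> /(IHf _ _ le)-> /(IHg _ _ le)->.
all: exact: IHf.
Qed.

Lemma tclosed_subst s k m t :
  (forall n, n < k -> tclosed m (s n)) -> tclosed k t -> tclosed m (tsubst s t).
Proof.
move=> E; elim: t => //= t IH u IHu.
all: by case/andP=> /IH-> /IHu->.
Qed.

Lemma fclosed_subst p (f : form p) s k m :
  (forall n, n < k -> tclosed m (s n)) -> fclosed k f -> fclosed m (fsubst s f).
Proof.
elim: f s k m => //= [t u|t u|h t|f IHf g IHg|f IHf g IHg|f IHf g IHg|f IHf|f IHf]
  s k m E.
1,2: by case/andP=> /(tclosed_subst E)-> /(tclosed_subst E)->.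
1: exact: tclosed_subst.
1-3: by case/andP=> /(IHf _ _ _ E)-> /(IHg _ _ _ E)->.
all: by apply: IHf => -[|n] //= lt; apply: (tclosed_subst (k := m)) (E _ lt).
Qed.

Fixpoint tfv (t : term) : nat :=
  match t with
  | tvar n => n.+1
  | tzero => 0
  | tsucc t => tfv t
  | tadd t u | tmul t u => maxn (tfv t) (tfv u)
  end.

Lemma tclosed_tfv t : tclosed (tfv t) t.
Proof.
elim: t => //= t IH u IHu.
all: rewrite (tclosed_mono _ IH) ?leq_maxl //.
all: by rewrite (tclosed_mono _ IHu) ?leq_maxr.
Qed.

Lemma fclosed_ex p (f : form p) : exists k, fclosed k f.
Proof.
elim: f => [|t u|t u|h t|f [k IHf] g [m IHg]|f [k IHf] g [m IHg]|f [k IHf] g [m IHg]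
  |f [k IHf]|f [k IHf]] /=.
- by exists 0.
1,2: exists (maxn (tfv t) (tfv u)); rewrite (tclosed_mono _ (tclosed_tfv t)) ?leq_maxl //.
1,2: by rewrite (tclosed_mono _ (tclosed_tfv u)) ?leq_maxr.
- by exists (tfv t); apply: tclosed_tfv.
1-3: exists (maxn k m); rewrite (fclosed_mono _ IHf) ?leq_maxl //.
1-3: by rewrite (fclosed_mono _ IHg) ?leq_maxr.
all: by exists k; apply: fclosed_mono IHf.
Qed.

(** The renaming brings the fresh variable [tvar k] back to index 0 and shifts the others up,
    trading a Henkin witness for an eigenvariable. *)
Lemma fshift_inst p (f : form p) k :
  fclosed k.+1 f ->
  fsubst (fun n => if n == k then tvar 0 else tvar n.+1) (finst (tvar k) f) = f.
Proof.
move=> cl; rewrite /finst fsubst_comp -[RHS]fsubst_id.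
apply: fsubst_closed cl => -[|n] /=; first by rewrite eqxx.
by rewrite ltnS => lt; rewrite ltn_eqF.
Qed.

(** * Derivations *)

Lemma prv_weak p G (f : form p) : prv G f -> forall G', incl G G' -> prv G' f.
Proof.
have inclc (a : form p) G1 G2 : incl G1 G2 -> incl (a :: G1) (a :: G2).
  by move=> I x /= [->|/I]; auto.
have inclm (h : form p -> form p) G1 G2 : incl G1 G2 -> incl (map h G1) (map h G2).
  move=> I x /in_map_iff [y [<- /I ?]]; apply/in_map_iff; by exists y.
elim=> {G f} /=.
- by move=> G f ? G' I; apply/prv_ax/I.
- by move=> G f _ IH G' I; apply: prv_raa; apply: IH; apply: inclc.
- by move=> G f g _ IH G' I; apply: prv_impI; apply: IH; apply: inclc.
- by move=> G f g _ IH _ IHf G' I; apply: prv_impE (IH _ I) (IHf _ I).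
- by move=> G f g _ IH _ IHf G' I; apply: prv_andI (IH _ I) (IHf _ I).
- by move=> G f g _ IH G' I; apply: prv_andE1 (IH _ I).
- by move=> G f g _ IH G' I; apply: prv_andE2 (IH _ I).
- by move=> G f g _ IH G' I; apply/prv_orI1/IH.
- by move=> G f g _ IH G' I; apply/prv_orI2/IH.
- move=> G f g h _ IH _ IHf _ IHg G' I.
  by apply: (prv_orE (IH _ I)); [apply: IHf | apply: IHg]; apply: inclc.
- by move=> G f _ IH G' I; apply/prv_allI/IH/inclm.
- by move=> G f t _ IH G' I; apply/prv_allE/IH.
- by move=> G f t _ IH G' I; apply/prv_exI/IH.
- move=> G f g _ IH _ IHf G' I.
  by apply: (prv_exE (IH _ I)); apply: IHf; apply: inclc; apply: inclm.
- by move=> *; apply: prv_eqI.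
- by move=> G f t u _ IH _ IHf G' I; apply: prv_eqE (IH _ I) (IHf _ I).
Qed.

Lemma prv_subst p G (f : form p) :
  prv G f -> forall s, prv (map (fsubst s) G) (fsubst s f).
Proof.
have mapE (H : seq (form p)) s :
    map (fsubst (sup s)) (map (@fshift p) H) = map (@fshift p) (map (fsubst s) H).
  by rewrite -!map_comp; apply: eq_map => g /=; rewrite fsubst_shift.
elim=> {G f} /=.
- by move=> G f I s; apply: prv_ax; apply: in_map.
- by move=> G f _ IH s; apply: prv_raa (IH s).
- by move=> G f g _ IH s; apply: prv_impI (IH s).
- by move=> G f g _ IH _ IHf s; apply: prv_impE (IH s) (IHf s).
- by move=> G f g _ IH _ IHf s; apply: prv_andI (IH s) (IHf s).
- by move=> G f g _ IH s; apply: prv_andE1 (IH s).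
- by move=> G f g _ IH s; apply: prv_andE2 (IH s).
- by move=> G f g _ IH s; apply/prv_orI1/IH.
- by move=> G f g _ IH s; apply/prv_orI2/IH.
- by move=> G f g h _ IH _ IHf _ IHg s; apply: prv_orE (IH s) (IHf s) (IHg s).
- by move=> G f _ IH s; apply: prv_allI; rewrite -mapE.
- by move=> G f t _ IH s; rewrite fsubst_inst; apply: prv_allE.
- by move=> G f t _ IH s; apply: (prv_exI (t := tsubst s t)); rewrite -fsubst_inst.
- move=> G f g _ IH _ IH' s; apply: prv_exE (IH s) _.
  by rewrite -mapE -fsubst_shift; apply: IH'.
- by move=> *; apply: prv_eqI.
- move=> G f t u _ IH _ IH' s; rewrite fsubst_inst; apply: prv_eqE (IH s) _.
  by rewrite -fsubst_inst.
Qed.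

Lemma prv_exfalso p G (f : form p) : prv G fbot -> prv G f.
Proof. by move=> h; apply: prv_raa; apply: prv_weak h _ _; right. Qed.

Definition extend p (T : theory p) (f : form p) : theory p := fun g => T g \/ g = f.

Definition consistent p (T : theory p) : Prop := ~ proves T fbot.

Lemma proves_ax p (T : theory p) f : T f -> proves T f.
Proof.
by move=> Tf; exists [:: f]; [move=> g /= [<-|] | apply: prv_ax; left].
Qed.

Lemma proves_mono p (T U : theory p) f :
  (forall g, T g -> U g) -> proves T f -> proves U f.
Proof. by move=> sub [G GT pf]; exists G => // g /GT/sub. Qed.

(** The deduction theorem: all occurrences of [f] among the premises used are discharged at once. *)
Lemma proves_imp p (T : theory p) f g : proves (extend T f) g -> proves T (fimp f g).
Proof.
case=> G2 T2 pg.
have [G3 T3 I3] : exists2 G3, (forall g, In g G3 -> T g) & incl G2 (f :: G3).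
  elim: G2 T2 {pg} => [|a G2 IH] T2; first by exists [::].
  have [|G3 T3 I3] := IH; first by move=> x xG; apply: T2; right.
  case: (T2 a (or_introl erefl)) => [Ta| ->].
    exists (a :: G3) => [x /= [<-|/T3]|x /= [<-|/I3 /=]] //; tauto.
  by exists G3 => // x /= [<-|/I3 /=]; tauto.
by exists G3 => //; apply: prv_impI; apply: prv_weak pg _ I3.
Qed.

Lemma proves_cut p (T : theory p) f g :
  proves T f -> proves (extend T f) g -> proves T g.
Proof.
move=> [G1 T1 pf] /proves_imp [G2 T2 pg].
exists (G1 ++ G2) => [x /(@in_app_or _ G1 G2) [/T1|/T2] //|].
apply: (prv_impE (prv_weak pg _) (prv_weak pf _)) => x xG; apply: in_or_app; tauto.
Qed.

(** A free variable plays the Henkin constant: renaming [tvar k] to the eigenvariable of [prv_exE]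
    turns a refutation of the instance into one from [fex f]. *)
Lemma consistent_henkin p (T : theory p) (f : form p) k :
  (forall g, T g -> fclosed k g) -> fclosed k.+1 f -> T (fex f) ->
  consistent T -> consistent (extend T (finst (tvar k) f)).
Proof.
move=> clT clf Tf con /proves_imp [G GT pf]; apply: con.
exists (fex f :: G) => [g /= [<-|/GT] //|].
apply: (@prv_exE _ _ f); first by apply: prv_ax; left.
set s := fun n => if n == k then tvar 0 else tvar n.+1.
have := prv_subst pf s; rewrite /= fshift_inst // => /prv_weak pf'.
apply: (@prv_impE _ _ f); last by apply: prv_ax; left.
(* On premises from [T], which do not contain [tvar k], the renaming [s] acts as a shift. *)
apply: pf' => g /in_map_iff [h [<- hG]]; right; right; apply/in_map_iff.
exists h; split=> //; apply: fsubst_closed (clT _ (GT _ hG)) => n lt.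
by rewrite /s ltn_eqF.
Qed.

(** * Henkin extensions *)

Section Henkin.

Variables (p : bool) (T0 : theory p).
Hypotheses (T0_closed : forall g, T0 g -> sentence g) (T0_con : consistent T0).

(** An enumeration of all formulas, obtained by inverting [fgn]; a number that codes no formula
    yields an arbitrary one. *)
Definition fenum (n : nat) : form p := epsilon (inhabits fbot) (fun f => fgn f = n).

Lemma fenumK f : fenum (fgn f) = f.
Proof.
apply: fgn_inj.
by apply: (epsilon_spec (inhabits fbot) (fun g => fgn g = fgn f)); exists f.
Qed.

Definition fbound (f : form p) : nat := epsilon (inhabits 0) (fun k => fclosed k f).

Lemma fboundP f : fclosed (fbound f) f.
Proof. exact: (epsilon_spec (inhabits 0) (fun k => fclosed k f) (fclosed_ex f)). Qed.

(** Bounds the variables of [stage n], so that fresh variables always remain as witnesses within the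
    same language. *)
Fixpoint fresh_var (n : nat) : nat :=
  if n is m.+1 then (maxn (fresh_var m) (fbound (fenum m))).+1 else 0.

(** The Lindenbaum and Henkin steps in one: an existential formula receives its witness at the step
    that accepts it. *)
Fixpoint stage (n : nat) : theory p :=
  if n is m.+1 then
    fun g => stage m g \/
      consistent (extend (stage m) (fenum m)) /\
      (g = fenum m \/
       exists2 h, fenum m = fex h
         & g = finst (tvar (maxn (fresh_var m) (fbound (fenum m)))) h)
  else T0.

Definition henkin : theory p := fun g => exists n, stage n g.

Lemma stage_closed n g : stage n g -> fclosed (fresh_var n) g.
Proof.
elim: n g => [|n IH] g /=; first exact: T0_closed.
set m := maxn _ _.
case=> [/IH|[_ [->|[h E ->]]]].
- by apply: fclosed_mono; rewrite leqW ?leq_maxl.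
- by apply: fclosed_mono (fboundP _); rewrite leqW ?leq_maxr.
have := fboundP (fenum n); rewrite [X in fclosed _ X]E /= => clh.
apply: (fclosed_subst (k := m.+1)); last by apply: fclosed_mono clh; rewrite ltnS leq_maxr.
by case=> [|i] //= lt; rewrite ltnS ltnW.
Qed.

Lemma stage_con n : consistent (stage n).
Proof.
elim: n => //= n IH; set m := maxn _ _.
case: (classic (consistent (extend (stage n) (fenum n)))) => [con|ncon]; last first.
  by move=> pf; apply: IH; apply: proves_mono pf => g [//|[]].
case: (classic (exists h, fenum n = fex h)) => [[h E]|nE]; last first.
  move=> pf; apply: con; apply: proves_mono pf => g [|[_ [|[h E]]]]; [by left|by right|].
  by case: nE; exists h.
have := fboundP (fenum n); rewrite E /= => clh.
have clm : fclosed m.+1 h by apply: fclosed_mono clh; rewrite ltnS /m E leq_maxr.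
have := @consistent_henkin _ (extend (stage n) (fenum n)) h m _ clm _ con.
move=> hen pf; apply: hen.
- move=> g [/stage_closed|->]; first by apply: fclosed_mono; apply: leq_maxl.
  by apply: fclosed_mono (fboundP _); apply: leq_maxr.
- by right.
apply: proves_mono pf => g [|[_ [->|[h']]]].
- by left; left.
- by left; right.
by rewrite E => -[<-] ->; right; rewrite /m E.
Qed.

Lemma stage_mono m n g : m <= n -> stage m g -> stage n g.
Proof.
move=> /subnKC <-; elim: (n - m) => [|k IH]; rewrite ?addn0 // addnS => /IH.
by left.
Qed.

Lemma henkin_sub g : T0 g -> henkin g.
Proof. by exists 0. Qed.

Lemma henkin_con : consistent henkin.
Proof.
case=> G GH pf.
have [n Gn] : exists n, forall g, In g G -> stage n g.
  elim: G GH {pf} => [|a G IH] GH; first by exists 0.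
  have [|n Gn] := IH; first by move=> g gG; apply: GH; right.
  have [m am] := GH a (or_introl erefl).
  exists (maxn m n) => g /= [<-|/Gn gn].
    by apply: stage_mono am; apply: leq_maxl.
  by apply: stage_mono gn; apply: leq_maxr.
by apply: (@stage_con n); exists G.
Qed.

(** The formula [f] is examined at stage [fgn f]; being consistent with the whole union, it is
    consistent with that stage and accepted there. *)
Lemma henkin_max f : consistent (extend henkin f) -> henkin f.
Proof.
move=> con; exists (fgn f).+1 => /=; right; rewrite fenumK; split; last by left.
move=> pf; apply: con; apply: proves_mono pf => g [gn|->]; last by right.
by left; exists (fgn f).
Qed.

Lemma henkin_proves f : proves henkin f -> henkin f.
Proof. by move=> pf; apply: henkin_max => /(proves_cut pf); apply: henkin_con. Qed.

Lemma henkin_closed G f : prv G f -> (forall g, In g G -> henkin g) -> henkin f.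
Proof. by move=> pf GH; apply: henkin_proves; exists G. Qed.

Lemma henkin_witness f : henkin (fex f) -> exists t, henkin (finst t f).
Proof.
move=> Hf; set n := fgn (fex f).
exists (tvar (maxn (fresh_var n) (fbound (fenum n)))), n.+1 => /=; right.
split; last by right; exists f => //; rewrite fenumK.
rewrite fenumK => pf; apply: henkin_con; apply: proves_mono pf => g [gn|->] //.
by exists n.
Qed.

Lemma henkin_imp f g : henkin (fimp f g) <-> (henkin f -> henkin g).
Proof.
split=> [Hi Hf|Hi].
  apply: (@henkin_closed [:: fimp f g; f]); last by move=> h /= [<-|[<-|]].
  by apply: (@prv_impE _ _ f); apply: prv_ax; [left|right; left].
apply: henkin_proves; apply: proves_imp.
case: (classic (henkin f)) => [/Hi Hg|nf].
  by apply: proves_ax; left.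
have [G GH pf] : proves (extend henkin f) fbot.
  by apply: NNPP => con; apply: nf; apply: henkin_max.
by exists G => //; apply: prv_exfalso.
Qed.

Lemma henkin_bot : ~ henkin fbot.
Proof. by move=> /proves_ax; apply: henkin_con. Qed.

Lemma henkin_neg f : henkin (fneg f) <-> ~ henkin f.
Proof.
split=> [/henkin_imp h /h/henkin_bot //|nf].
by apply/henkin_imp => /nf.
Qed.

Lemma henkin_and f g : henkin (fand f g) <-> henkin f /\ henkin g.
Proof.
split=> [H|[Hf Hg]].
  split; apply: (@henkin_closed [:: fand f g]); try by move=> h /= [<-|].
    by apply: (@prv_andE1 _ _ f g); apply: prv_ax; left.
  by apply: (@prv_andE2 _ _ f g); apply: prv_ax; left.
apply: (@henkin_closed [:: f; g]); last by move=> h /= [<-|[<-|]].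
by apply: prv_andI; apply: prv_ax; [left|right; left].
Qed.

Lemma henkin_or f g : henkin (for_ f g) <-> henkin f \/ henkin g.
Proof.
split=> [H|[Hf|Hg]].
- apply: NNPP => nH; have [nf ng] : henkin (fneg f) /\ henkin (fneg g).
    by split; apply/henkin_neg; tauto.
  apply: henkin_bot.
  apply: (@henkin_closed [:: for_ f g; fneg f; fneg g]).
    apply: (@prv_orE _ _ f g); first by apply: prv_ax; left.
      apply: (@prv_impE _ _ f); apply: prv_ax; rewrite /=; tauto.
    apply: (@prv_impE _ _ g); apply: prv_ax; rewrite /=; tauto.
  by move=> h /= [<-|[<-|[<-|]]].
- apply: (@henkin_closed [:: f]); last by move=> h /= [<-|].
  by apply: prv_orI1; apply: prv_ax; left.
- apply: (@henkin_closed [:: g]); last by move=> h /= [<-|].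
  by apply: prv_orI2; apply: prv_ax; left.
Qed.

Lemma henkin_exists f : henkin (fex f) <-> exists t, henkin (finst t f).
Proof.
split=> [/henkin_witness //|[t Ht]].
apply: (@henkin_closed [:: finst t f]); last by move=> h /= [<-|].
by apply: (@prv_exI _ _ _ t); apply: prv_ax; left.
Qed.

Lemma henkin_forall f : henkin (fall f) <-> forall t, henkin (finst t f).
Proof.
split=> [Ha t|Ha].
  apply: (@henkin_closed [:: fall f]); last by move=> h /= [<-|].
  by apply: prv_allE; apply: prv_ax; left.
apply: NNPP => /henkin_neg nH.
have /henkin_witness [t] : henkin (fex (fneg f)).
  apply: (@henkin_closed [:: fneg (fall f)]); last by move=> h /= [<-|].
  apply: prv_raa; apply: (@prv_impE _ _ (fall f)).
    by apply: prv_ax; right; left.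
  apply: prv_allI; apply: prv_raa.
  (* The existential formula is the shift of [fex (fneg f)]; its instance at [tvar 0] is [fneg f]
     itself. *)
  set G := (_ :: _); apply: (@prv_impE _ G (fex (fneg (fsubst (sup (fun n => tvar n.+1)) f)))).
    by apply: prv_ax; right; left.
  apply: (@prv_exI _ _ _ (tvar 0)); apply: prv_ax; left.
  rewrite /finst -/(fneg _) /= fsubst_comp -[in LHS](fsubst_id f).
  by congr fimp; apply: eq_fsubst => -[].
rewrite /finst /= -/(fneg _) => h; exact: (proj1 (henkin_neg _) h (Ha t)).
Qed.

Lemma henkin_refl t : henkin (feq t t).
Proof. by apply: (@henkin_closed [::]) => //; apply: prv_eqI. Qed.

Lemma henkin_eqE f t u : henkin (feq t u) -> henkin (finst t f) -> henkin (finst u f).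
Proof.
move=> He Hf; apply: (@henkin_closed [:: feq t u; finst t f]).
  by apply: (@prv_eqE _ _ f t); apply: prv_ax; [left|right; left].
by move=> h /= [<-|[<-|]].
Qed.

Lemma tinst_shift t u : tsubst (scons u tvar) (tshift t) = t.
Proof. by rewrite /tshift tsubst_comp -[RHS]tsubst_id; apply: eq_tsubst. Qed.

Lemma henkin_sym t u : henkin (feq t u) -> henkin (feq u t).
Proof.
move=> He; have := @henkin_eqE (feq (tvar 0) (tshift t)) t u He.
by rewrite /finst /= !tinst_shift => h; apply: h (henkin_refl t).
Qed.

Lemma henkin_trans t u v : henkin (feq t u) -> henkin (feq u v) -> henkin (feq t v).
Proof.
move=> H1 H2; have := @henkin_eqE (feq (tshift t) (tvar 0)) u v H2.
by rewrite /finst /= !tinst_shift; apply.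
Qed.

Lemma henkin_rewrite f t u : henkin (feq t u) -> henkin (finst t f) <-> henkin (finst u f).
Proof. by move=> E; split; apply: henkin_eqE => //; apply: henkin_sym. Qed.

Lemma henkin_congr (c : term) t u :
  henkin (feq t u) ->
  henkin (feq (tsubst (scons t tvar) c) (tsubst (scons u tvar) c)).
Proof.
move=> E; have := @henkin_eqE (feq (tshift (tsubst (scons t tvar) c)) c) t u E.
by rewrite /finst /= !tinst_shift; apply; apply: henkin_refl.
Qed.

End Henkin.

(** * Models and completeness *)

Record model := Model {
  dom :> Type;
  mzero : dom;
  msucc : dom -> dom;
  madd : dom -> dom -> dom;
  mmul : dom -> dom -> dom;
  mle : dom -> dom -> Prop;
  mP : dom -> Prop
}.

Fixpoint meval (M : model) (e : nat -> M) (t : term) : M :=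
  match t with
  | tvar n => e n
  | tzero => mzero M
  | tsucc t => msucc (meval e t)
  | tadd t u => madd (meval e t) (meval e u)
  | tmul t u => mmul (meval e t) (meval e u)
  end.

Fixpoint sat (M : model) p (e : nat -> M) (f : form p) : Prop :=
  match f with
  | fbot => False
  | feq t u => meval e t = meval e u
  | fle t u => mle (meval e t) (meval e u)
  | fP _ t => mP (meval e t)
  | fimp f g => sat e f -> sat e g
  | fand f g => sat e f /\ sat e g
  | for_ f g => sat e f \/ sat e g
  | fall f => forall x, sat (scons x e) f
  | fex f => exists x, sat (scons x e) f
  end.

Lemma meval_closed (M : model) k t (e e' : nat -> M) :
  (forall n, n < k -> e n = e' n) -> tclosed k t -> meval e t = meval e' t.
Proof.
move=> E; elim: t => //= [t IH|t IH u IHu|t IH u IHu].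
- by move=> /IH->.
- by case/andP=> /IH-> /IHu->.
- by case/andP=> /IH-> /IHu->.
Qed.

Lemma sat_closed (M : model) p (f : form p) k (e e' : nat -> M) :
  (forall n, n < k -> e n = e' n) -> fclosed k f -> sat e f <-> sat e' f.
Proof.
elim: f k e e' => //= [t u|t u|h t|f IHf g IHg|f IHf g IHg|f IHf g IHg|f IHf|f IHf]
  k e e' E.
1,2: by case/andP=> /(meval_closed E)-> /(meval_closed E)->.
1: by move=> /(meval_closed E)->.
1-3: by case/andP=> /(IHf _ _ _ E)? /(IHg _ _ _ E)?; tauto.
all: move=> cl; have S x : sat (scons x e) f <-> sat (scons x e') f
  by apply: IHf cl; case.
- by split=> h x; apply/S.
- by split=> -[x /S]; exists x.
Qed.

(** * The term model of a Henkin theory *)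

Section TermModel.

Variables (p : bool) (T0 : theory p).
Hypotheses (T0_closed : forall g, T0 g -> sentence g) (T0_con : consistent T0).

Local Notation H := (henkin T0).

(** Terms whose equation lies in [H] get the same representative, because [epsilon] then receives
    predicates that are equal by extensionality. The quotient is encoded as the set of
    representatives. *)
Definition trep (t : term) : term := epsilon (inhabits tzero) (fun u => H (feq t u)).

Lemma trepP t : H (feq t (trep t)).
Proof.
by apply: (epsilon_spec (inhabits tzero) (fun u => H (feq t u))); exists t; apply: henkin_refl.
Qed.

Lemma trep_eq t u : trep t = trep u <-> H (feq t u).
Proof.
split=> [E|E].
  apply: henkin_trans (trepP t) _ => //; rewrite E.
  by apply: henkin_sym => //; apply: trepP.
rewrite /trep; congr epsilon; apply: functional_extensionality.
move=> v; apply: propositional_extensionality.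
by split=> h; apply: henkin_trans h => //; apply: henkin_sym.
Qed.

Definition tclass_type := {t : term | trep t = t}.

Lemma trep_idem t : trep (trep t) = trep t.
Proof. by apply/trep_eq; apply: henkin_sym => //; apply: trepP. Qed.

Definition tclass (t : term) : tclass_type := exist _ (trep t) (trep_idem t).

Lemma tclass_eq t u : tclass t = tclass u <-> H (feq t u).
Proof.
split=> [[]|] /trep_eq // E.
by apply: subset_eq_compat; rewrite E.
Qed.

Lemma tclassK (c : tclass_type) : tclass (sval c) = c.
Proof. by case: c => t E; apply: subset_eq_compat. Qed.

(** The interpretation of P asks for a proof of [p], so it is empty when P is absent from the
    signature. *)
Definition term_model : model :=
  @Model tclass_type (tclass tzero)
    (fun c => tclass (tsucc (sval c)))
    (fun c d => tclass (tadd (sval c) (sval d)))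
    (fun c d => tclass (tmul (sval c) (sval d)))
    (fun c d => H (fle (sval c) (sval d)))
    (fun c => exists h : p, H (fP h (sval c))).

Lemma meval_term (s : nat -> term) t :
  meval (M := term_model) (fun n => tclass (s n)) t = tclass (tsubst s t).
Proof.
have C c t1 t2 : H (feq t1 t2) ->
    tclass (tsubst (scons t1 tvar) c) = tclass (tsubst (scons t2 tvar) c).
  by move=> E; apply/tclass_eq; apply: henkin_congr.
have R t1 : H (feq (trep t1) t1) by apply: henkin_sym => //; apply: trepP.
elim: t => //= [t ->|t -> u ->|t -> u ->] /=.
- exact: (C (tsucc (tvar 0)) _ _ (R _)).
- have := C (tadd (tvar 0) (tshift (trep (tsubst s u)))) _ _ (R (tsubst s t)).
  rewrite /= !tinst_shift => ->.
  have := C (tadd (tshift (tsubst s t)) (tvar 0)) _ _ (R (tsubst s u)).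
  by rewrite /= !tinst_shift.
- have := C (tmul (tvar 0) (tshift (trep (tsubst s u)))) _ _ (R (tsubst s t)).
  rewrite /= !tinst_shift => ->.
  have := C (tmul (tshift (tsubst s t)) (tvar 0)) _ _ (R (tsubst s u)).
  by rewrite /= !tinst_shift.
Qed.

(** The truth lemma. The substitution is arbitrary so that the quantifier cases can extend it by a
    term; every element of the model is the class of a term. *)
Lemma sat_term (f : form p) (s : nat -> term) (e : nat -> term_model) :
  (forall n, e n = tclass (s n)) -> sat e f <-> H (fsubst s f).
Proof.
have R t : H (feq (trep t) t) by apply: henkin_sym => //; apply: trepP.
have ev s' e' t : (forall n, e' n = tclass (s' n)) ->
    meval (M := term_model) e' t = tclass (tsubst s' t).
  by move=> E; rewrite -meval_term; apply: meval_closed (tclosed_tfv t).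
elim: f s e => /= [|t u|t u|h t|f IHf g IHg|f IHf g IHg|f IHf g IHg|f IHf|f IHf] s e E.
- by split=> // /henkin_bot; apply.
- by rewrite !(ev _ _ _ E) tclass_eq.
- rewrite !(ev _ _ _ E) /=.
  have := @henkin_rewrite _ _ T0_closed T0_con (fle (tvar 0) (tshift (trep (tsubst s u))))
    _ _ (R (tsubst s t)).
  rewrite /finst /= !tinst_shift => ->.
  have := @henkin_rewrite _ _ T0_closed T0_con (fle (tshift (tsubst s t)) (tvar 0))
    _ _ (R (tsubst s u)).
  by rewrite /finst /= !tinst_shift => ->.
- rewrite !(ev _ _ _ E) /=.
  have := @henkin_rewrite _ _ T0_closed T0_con (fP h (tvar 0)) _ _ (R (tsubst s t)).
  rewrite /finst /= => <-; split=> [[h']|]; last by exists h.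
  by rewrite (bool_irrelevance h' h).
- by rewrite henkin_imp // (IHf _ _ E) (IHg _ _ E).
- by rewrite henkin_and // (IHf _ _ E) (IHg _ _ E).
- by rewrite henkin_or // (IHf _ _ E) (IHg _ _ E).
- rewrite henkin_forall //; split=> Ha t.
    rewrite finst_sup; apply/(IHf _ (scons (tclass t) e)); last exact: Ha.
    by case.
  apply/(IHf (scons (sval t) s)); last by rewrite -finst_sup.
  by case=> //=; rewrite tclassK.
- rewrite henkin_exists //; split=> -[t].
    move/(IHf (scons (sval t) s)); rewrite -finst_sup => Ht.
    by exists (sval t); apply: Ht; case=> //=; rewrite tclassK.
  rewrite finst_sup => Ht; exists (tclass t).
  by apply/(IHf (scons t s)) => //; case.
Qed.

End TermModel.

(** If [f] is not provable, [extend T (fneg f)] is consistent, and its term model, with each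
    variable interpreted by its own class, is a countermodel. *)
Theorem completeness p (T : theory p) (f : form p) :
  (forall g, T g -> sentence g) -> sentence f ->
  (forall (M : model) (e : nat -> M), (forall g, T g -> sat e g) -> sat e f) ->
  proves T f.
Proof.
move=> clT clf val; apply: NNPP => npf.
have clT' g : extend T (fneg f) g -> sentence g.
  by move=> [/clT //|->]; rewrite /sentence /= andbT.
have con : consistent (extend T (fneg f)).
  move=> /proves_imp [G GT pf]; apply: npf; exists G => //.
  apply: prv_raa; apply: (@prv_impE _ _ (fneg f)); last by apply: prv_ax; left.
  by apply: prv_weak pf _ _; right.
pose e n : term_model clT' con := tclass clT' con (tvar n).
have tr g : sat e g <-> henkin (extend T (fneg f)) g.
  by rewrite (@sat_term _ _ clT' con g tvar e) // fsubst_id.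
have : henkin (extend T (fneg f)) (fneg f) by apply: henkin_sub; right.
move/(henkin_neg clT' con); apply; apply/tr; apply: val => g Tg; apply/tr.
by apply: henkin_sub; left.
Qed.

(** * Recursive functions *)

(** Composing [f] with all projections leaves its values unchanged, and [rec_comp] asks only for a
    pointwise equation. *)
Lemma eq_recursive k (f g : k.-tuple nat -> nat) : f =1 g -> recursive f -> recursive g.
Proof.
move=> E rf; pose h (i : 'I_k) (v : k.-tuple nat) := tnth v i.
apply: (rec_comp rf (h := h)) => [i|v]; first exact: rec_proj.
by rewrite -E; congr f; apply: eq_from_tnth => i; rewrite tnth_mktuple.
Qed.

Definition rec1 (f : nat -> nat) : Prop :=
  recursive (fun v : 1.-tuple nat => f (tnth v ord0)).

Definition rec2 (f : nat -> nat -> nat) : Prop :=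
  recursive (fun v : 2.-tuple nat => f (tnth v ord0) (tnth v (lift ord0 ord0))).

Lemma rec_comp1 k (g : nat -> nat) (h : k.-tuple nat -> nat) :
  rec1 g -> recursive h -> recursive (fun v => g (h v)).
Proof.
move=> rg rh; apply: (rec_comp rg (h := fun _ => h)) => // v.
by rewrite tnth_mktuple.
Qed.

Lemma rec_comp2 k (g : nat -> nat -> nat) (h1 h2 : k.-tuple nat -> nat) :
  rec2 g -> recursive h1 -> recursive h2 -> recursive (fun v => g (h1 v) (h2 v)).
Proof.
move=> rg r1 r2.
apply: (rec_comp rg (h := fun i : 'I_2 => if i == ord0 then h1 else h2)) => [i|v].
  by case: ifP.
by rewrite !tnth_mktuple.
Qed.

Lemma rec_succ1 : rec1 succn.
Proof. by apply: rec_succ. Qed.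

Lemma rec_const k n : recursive (fun _ : k.-tuple nat => n).
Proof.
elim: n => [|n IH]; first exact: rec_zero.
exact: rec_comp1 rec_succ1 IH.
Qed.

Lemma rec_prim1 a (h : nat -> nat -> nat) (f : nat -> nat) :
  rec2 h -> f 0 = a -> (forall n, f n.+1 = h n (f n)) -> rec1 f.
Proof.
move=> rh f0 fS; apply: (rec_prec (rec_const 0 a) rh) => [v|n v]; first exact: f0.
exact: fS.
Qed.

Lemma rec_prim2 (g : nat -> nat) (h : 3.-tuple nat -> nat) (f : nat -> nat -> nat) :
  rec1 g -> recursive h -> (forall x, f 0 x = g x) ->
  (forall n x, f n.+1 x = h [tuple n; f n x; x]) -> rec2 f.
Proof.
move=> rg rh f0 fS; apply: (rec_prec rg rh) => [v|n v].
  by rewrite !(tnth_nth 0) /= f0.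
rewrite !(tnth_nth 0) /= fS; congr h; apply: val_inj => /=.
by case: v => -[|x [|]].
Qed.

Lemma rec_iter2 (h : nat -> nat) : rec1 h -> rec2 (fun n x => iter n h x).
Proof.
move=> rh; apply: (@rec_prim2 id (fun v => h (tnth v (lift ord0 ord0)))) => //.
- exact: rec_proj.
- by apply: rec_comp1 => //; apply: rec_proj.
Qed.

Lemma rec_id : rec1 id.
Proof. exact: rec_proj. Qed.

Lemma rec_add : rec2 addn.
Proof.
apply: (@rec_prim2 id (fun v => (tnth v (lift ord0 ord0)).+1)) => //.
- exact: rec_id.
- by apply: rec_comp1 rec_succ1 _; apply: rec_proj.
Qed.

Lemma rec_pred : rec1 predn.
Proof. by apply: (@rec_prim1 0 (fun n _ => n)) => //; apply: rec_proj. Qed.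

Lemma rec_swap (f : nat -> nat -> nat) : rec2 f -> rec2 (fun x y => f y x).
Proof. by move=> rf; apply: rec_comp2 rf _ _; apply: rec_proj. Qed.

Lemma rec_sub : rec2 subn.
Proof.
apply: (@rec_swap (fun x y => y - x)).
have E x y : iter x predn y = y - x.
  by elim: x => [|x IH]; [rewrite subn0 | rewrite iterS IH subnS].
by apply: eq_recursive (rec_iter2 rec_pred) => v; apply: E.
Qed.

Lemma rec_bin2 : rec1 (fun n => 'C(n, 2)).
Proof.
apply: (@rec_prim1 0 (fun n x => x + n)) => //; first exact: rec_swap rec_add.
by move=> n; rewrite binS bin1.
Qed.

Lemma rec_cpair : rec2 cpair.
Proof.
apply: rec_comp2 rec_add _ _; last exact: rec_proj.
by apply: rec_comp1 rec_bin2 _; apply: rec_comp1 rec_succ1 _; apply: rec_add.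
Qed.

Lemma rec_cpair1 k a (h : k.-tuple nat -> nat) :
  recursive h -> recursive (fun v => cpair a (h v)).
Proof. by apply: rec_comp2 rec_cpair (rec_const k a). Qed.

(** * The inverse of the pairing function *)

Lemma ltn_bin2 n : n < 'C(n.+2, 2).
Proof. by elim: n => //= n IH; rewrite binS bin1; lia. Qed.

(** The sum of the two components of the pair coded by [n]: the pairs with sum at most [s] have
    exactly the codes below ['C(s.+2, 2)]. *)
Definition cdiag (n : nat) : nat :=
  ex_minn (ex_intro (fun s => n < 'C(s.+2, 2)) n (ltn_bin2 n)).

Definition csnd (n : nat) : nat := n - 'C((cdiag n).+1, 2).
Definition cfst (n : nat) : nat := cdiag n - csnd n.

Lemma cdiag_cpair a b : cdiag (cpair a b) = a + b.
Proof.
rewrite /cdiag; case: ex_minnP => s lt min.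
have le : s <= a + b.
  by apply: min; rewrite /cpair [in X in _ < X]binS bin1; lia.
apply/eqP; rewrite eqn_leq le leqNgt; apply/negP => lt'.
have : 'C(s.+2, 2) <= 'C((a + b).+1, 2) by apply: leq_bin2l.
by move: lt; rewrite /cpair; lia.
Qed.

Lemma csnd_cpair a b : csnd (cpair a b) = b.
Proof. by rewrite /csnd cdiag_cpair /cpair addKn. Qed.

Lemma cfst_cpair a b : cfst (cpair a b) = a.
Proof. by rewrite /cfst csnd_cpair cdiag_cpair addnK. Qed.

(** Minimization searches for a zero, and the truncated difference of [n.+1] and ['C(s.+2, 2)]
    vanishes exactly when [n < 'C(s.+2, 2)]. *)
Lemma rec_cdiag : rec1 cdiag.
Proof.
apply: (@rec_min _ (fun v : 2.-tuple nat =>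
  (tnth v (lift ord0 ord0)).+1 - 'C((tnth v ord0).+2, 2))).
- apply: rec_comp2 rec_sub _ _; first by apply: rec_comp1 rec_succ1 _; apply: rec_proj.
  apply: rec_comp1 rec_bin2 _; apply: rec_comp1 rec_succ1 _.
  by apply: rec_comp1 rec_succ1 _; apply: rec_proj.
- move=> v; rewrite !(tnth_nth 0) /=; case: v => -[|x [|]] //= _.
  by rewrite /cdiag; case: ex_minnP => s; lia.
- move=> v n; rewrite !(tnth_nth 0) /=; case: v => -[|x [|]] //= _.
  rewrite /cdiag; case: ex_minnP => s _ min lt E.
  by have : s <= n; [apply: min | ]; lia.
Qed.

Lemma rec_csnd : rec1 csnd.
Proof.
apply: rec_comp2 rec_sub rec_id _; apply: rec_comp1 rec_bin2 _.
exact: rec_comp1 rec_succ1 rec_cdiag.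
Qed.

Lemma rec_cfst : rec1 cfst.
Proof. exact: rec_comp2 rec_sub rec_cdiag rec_csnd. Qed.

(** The test is arithmetized: [1 - x] is 1 at zero and 0 elsewhere, so it and its complement serve
    as weights for the two branches. *)
Lemma rec_if1 (f g h : nat -> nat) :
  rec1 f -> rec1 g -> rec1 h -> rec1 (fun n => if f n == 0 then g n else h n).
Proof.
move=> rf rg rh.
have rsg : rec1 (fun n => 1 - n) by apply: rec_comp2 rec_sub (rec_const _ 1) rec_id.
have rmul : rec2 muln.
  apply: (@rec_prim2 (fun=> 0)
    (fun v => tnth v (lift ord0 (lift ord0 ord0)) + tnth v (lift ord0 ord0))) => //.
  - exact: rec_const.
  - by apply: rec_comp2 rec_add _ _; apply: rec_proj.
have := rec_comp2 rec_add
  (rec_comp2 rmul (rec_comp1 rsg rf) rg) (rec_comp2 rmul (rec_comp1 rsg (rec_comp1 rsg rf)) rh).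
apply: eq_recursive => v; by case: (f _) => [|n]; rewrite /= ?subn0 ?subn1 ?mul1n ?mul0n ?addn0.
Qed.

(** * The translation *)

(* [approx] says that P and the axioms of R_0 behave well up to w = [tvar 0];
   the two clauses [x + Sy <= w -> x + y <= w] and [x * Sy <= w -> x * y <= w]
   prevent sums and products exceeding w from wrapping around below w. *)
Definition approx : Lap :=
  let w1 := tvar 1 in let w2 := tvar 2 in
  let x := tvar 1 in let y := tvar 0 in
  fand (fle tzero (tvar 0))
  (fand (fall (fimp (fle (tvar 0) tzero) (feq (tvar 0) tzero)))
  (fall (fimp (fle (tvar 0) w1)
    (fand (fP isT (tvar 0))
    (fand (fle (tvar 0) (tvar 0))
    (fand (fneg (fle (tsucc (tvar 0)) (tvar 0)))
    (fand (for_ (feq (tvar 0) w1) (fle (tsucc (tvar 0)) w1))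
    (fand (feq (tadd (tvar 0) tzero) (tvar 0))
    (fand (feq (tmul (tvar 0) tzero) tzero)
    (fall
      (fand (fimp (fle y x) (fle y (tsucc x)))
      (fand (fimp (fle y (tsucc x)) (for_ (fle y x) (feq y (tsucc x))))
      (fimp (fle y w2)
        (fand (feq (tadd x (tsucc y)) (tsucc (tadd x y)))
        (fand (fimp (fle (tadd x (tsucc y)) w2) (fle (tadd x y) w2))
        (fand (fimp (fle (tmul x y) w2) (feq (tmul x (tsucc y)) (tadd (tmul x y) x)))
          (fimp (fle (tmul x (tsucc y)) w2) (fle (tmul x y) w2)))))))))))))))))).

(* Under the quantifiers for z and w: w = [tvar 0], z = [tvar 1], and the
   variables of the matrix of sigma start at [tvar 2].  The conjunct [1 <= z]
   rules out w = 0, for which [approx] does not exclude 2 = 0. *)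
Fixpoint vars_below (c : nat) : Lap :=
  if c is k.+1 then fand (fle (tvar k.+2) (tvar 1)) (vars_below k)
  else fand (fle (num 1) (tvar 1)) (fle (num 2) (tvar 1)).

(** Denotes z^(2^k). Squaring a number T >= 2 dominates successors, sums and products of numbers up
    to T, so the height of the tower can count term constructors. *)
Fixpoint tower (k : nat) : term :=
  if k is m.+1 then tmul (tower m) (tower m) else tvar 1.

Fixpoint tower_below (c : nat) : Lap :=
  if c is k.+1 then fand (fle (tower k.+1) (tvar 0)) (tower_below k)
  else fle (tower 0) (tvar 0).

Definition strip_ex p (f : form p) : form p := if f is fex g then g else f.

Definition certificate (c : nat) : Lap :=
  fex (fex (fand approx (fand (vars_below c) (tower_below c)))).

(** The Goedel number [c] bounds both the number of leading quantifiers of [s] and the height of the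
    tower that its matrix requires. *)
Definition certified (s : La) : Lap :=
  let c := fgn s in
  fand (emb s)
    (iter c (@fex true) (fand (emb (iter c (@strip_ex false) s)) (certificate c))).

(** * Effectiveness *)

Lemma cpair_ge a b : a + b <= cpair a b.
Proof.
rewrite /cpair; apply: leq_trans (leq_addr _ _).
by rewrite binS bin1 leq_addl.
Qed.

(* Keeps conversion from evaluating Goedel numbers in unary. *)
Local Opaque cpair.

Lemma fgn_emb f : fgn (emb f) = fgn f.
Proof. by elim: f => //= [f -> g ->|f -> g ->|f -> g ->|f ->|f ->]. Qed.

(** The tag of [fex] is 8, and the sum of the two truncated differences vanishes exactly when the
    tag is 8. *)
Definition cstrip (n : nat) : nat :=
  if (cfst n - 8) + (8 - cfst n) == 0 then csnd n else n.

Lemma fgn_strip p (f : form p) : fgn (strip_ex f) = cstrip (fgn f).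
Proof. by case: f => *; rewrite /cstrip /= cfst_cpair ?csnd_cpair. Qed.

Lemma rec_cstrip : rec1 cstrip.
Proof.
apply: rec_if1 rec_csnd rec_id.
apply: rec_comp2 rec_add _ _; apply: rec_comp2 rec_sub _ _;
  by [apply: rec_cfst | apply: rec_const].
Qed.

Lemma rec_tower : rec1 (fun k => tgn (tower k)).
Proof.
apply: (@rec_prim1 (tgn (tower 0)) (fun _ x => cpair 4 (cpair x x))) => //.
by apply: rec_cpair1; apply: rec_comp2 rec_cpair _ _; apply: rec_proj.
Qed.

Lemma rec_vars_below : rec1 (fun k => fgn (vars_below k)).
Proof.
apply: (@rec_prim1 (fgn (vars_below 0))
  (fun k x => cpair 5 (cpair (cpair 2 (cpair (cpair 0 k.+2) (cpair 0 1))) x))) => //.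
apply: rec_cpair1; apply: rec_comp2 rec_cpair _ _; last exact: rec_proj.
apply: rec_cpair1; apply: rec_comp2 rec_cpair _ _; last exact: rec_const.
apply: rec_cpair1; do 2!apply: rec_comp1 rec_succ1 _; exact: rec_proj.
Qed.

Lemma rec_tower_below : rec1 (fun k => fgn (tower_below k)).
Proof.
apply: (@rec_prim1 (fgn (tower_below 0))
  (fun k x => cpair 5 (cpair (cpair 2 (cpair (tgn (tower k.+1)) (cpair 0 0))) x))) => //.
apply: rec_cpair1; apply: rec_comp2 rec_cpair _ _; last exact: rec_proj.
apply: rec_cpair1; apply: rec_comp2 rec_cpair _ _; last exact: rec_const.
by apply: rec_comp1 rec_tower _; apply: rec_comp1 rec_succ1 _; apply: rec_proj.
Qed.

Lemma fgn_iter_ex p n (f : form p) : fgn (iter n (@fex p) f) = iter n (cpair 8) (fgn f).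
Proof. by elim: n => //= n ->. Qed.

Lemma fgn_iter_strip p n (f : form p) :
  fgn (iter n (@strip_ex p) f) = iter n cstrip (fgn f).
Proof. by elim: n => //= n <-; apply: fgn_strip. Qed.

(** On codes [emb] is the identity, and adding or removing a quantifier is [cpair 8] or [cstrip],
    iterated as often as the Goedel number says. *)
Lemma certified_effective (D : La -> Prop) : effective_on D certified.
Proof.
pose cert c := cpair 8 (cpair 8 (cpair 5 (cpair (fgn approx)
  (cpair 5 (cpair (fgn (vars_below c)) (fgn (tower_below c))))))).
pose F n := cpair 5 (cpair n
  (iter n (cpair 8) (cpair 5 (cpair (iter n cstrip n) (cert n))))).
exists (fun v => F (tnth v ord0)); last first.
  move=> f _; rewrite (tnth_nth 0) /= /certified /F /cert.
  by cbn [fgn certificate]; rewrite fgn_iter_ex; cbn [fgn]; rewrite !fgn_emb fgn_iter_strip.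
have rcert : rec1 cert.
  do 3!apply: rec_cpair1; apply: rec_cpair1; apply: rec_cpair1.
  exact: rec_comp2 rec_cpair rec_vars_below rec_tower_below.
have r8 : rec1 (cpair 8) by apply: rec_cpair1; apply: rec_proj.
apply: rec_cpair1; apply: rec_comp2 rec_cpair rec_id _.
apply: (rec_comp2 (rec_iter2 r8) rec_id); apply: rec_cpair1.
apply: rec_comp2 rec_cpair _ rcert.
exact: rec_comp2 (rec_iter2 rec_cstrip) rec_id rec_id.
Qed.

(** * Numerals in models *)

Definition mnum (M : model) (n : nat) : M := iter n (@msucc M) (mzero M).

Lemma meval_num (M : model) (e : nat -> M) n : meval e (num n) = mnum M n.
Proof. by elim: n => //= n ->. Qed.

(** The numerals up to [n] form a faithful initial segment of the model. In [exact_mul] the factors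
    are bounded separately, because a product with 0 says nothing about the size of the other
    factor. *)
Record exact_upto (M : model) (n : nat) : Prop := {
  exact_inj : forall a b, a <= n -> b <= n -> mnum M a = mnum M b -> a = b;
  exact_le : forall a b, a <= b -> b <= n -> mle (mnum M a) (mnum M b);
  exact_bound : forall x b, b <= n -> mle x (mnum M b) -> exists2 a, a <= b & x = mnum M a;
  exact_add : forall a b, a + b <= n -> madd (mnum M a) (mnum M b) = mnum M (a + b);
  exact_mul : forall a b, a <= n -> b <= n -> a * b <= n ->
    mmul (mnum M a) (mnum M b) = mnum M (a * b)
}.

Lemma exact_leE (M : model) n a b : exact_upto M n -> a <= n -> b <= n ->
  mle (mnum M a) (mnum M b) <-> a <= b.
Proof.
move=> ex an bn; split=> [|ab]; last exact: (exact_le ex).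
by move/(exact_bound ex bn) => [c cb /(exact_inj ex an (leq_trans cb bn)) ->].
Qed.

Lemma meval_shift (M : model) (e : nat -> M) x t : meval (scons x e) (tshift t) = meval e t.
Proof. by elim: t => //= [t ->|t -> u ->|t -> u ->]. Qed.

Lemma teval_shift e x t : teval (scons x e) (tshift t) = teval e t.
Proof. by elim: t => //= [t ->|t -> u ->|t -> u ->]. Qed.

(** * Evaluation of bounded formulas below the tower *)

Section Evaluation.

Variables (M : model) (z n c : nat).
Hypotheses (z_ge2 : 2 <= z) (ex : exact_upto M n) (tow : z ^ (2 ^ c) <= n).

Local Notation T k := (z ^ (2 ^ k)).

Lemma towerS k : T k.+1 = T k * T k.
Proof. by rewrite expnS mul2n -addnn expnD. Qed.

Lemma tower_ge2 k : 2 <= T k.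
Proof. by apply: leq_trans z_ge2 _; rewrite -{1}(expn1 z) leq_pexp2l ?expn_gt0 // ltnW. Qed.

Lemma tower_mono k m : k <= m -> T k <= T m.
Proof. by move=> km; rewrite leq_pexp2l ?leq_pexp2l // ltnW. Qed.

Lemma tower_max k m a : k <= m -> a <= T k -> a <= T m.
Proof. by move=> km ak; apply: leq_trans ak (tower_mono km). Qed.

(** Each successor, sum or product spends one squaring; its code exceeds the sum of the codes of its
    parts by [cpair_ge], the tag being positive. *)
Lemma teval_tower e k t :
  (forall i, e i <= T k) -> teval e t <= T (k + tgn t).
Proof.
move=> ek; elim: t => [i||t IH|t IH u IHu|t IH u IHu]; cbn [teval tgn].
- by apply: tower_max (ek i); apply: leq_addr.
- by [].
- have le : (k + tgn t).+1 <= k + cpair 2 (tgn t) by have := cpair_ge 2 (tgn t); lia.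
  by apply: tower_max le _; rewrite towerS; have := tower_ge2 (k + tgn t); nia.
all: match goal with |- context [cpair ?a (cpair ?b ?d)] =>
  have := cpair_ge a (cpair b d); have := cpair_ge b d; set m := cpair a _ end.
all: move=> h1 h2; have le : (k + (tgn t + tgn u)).+1 <= k + m by lia.
all: apply: tower_max le _; rewrite towerS.
all: have {}IH : teval e t <= T (k + (tgn t + tgn u)) by apply: tower_max IH; lia.
all: have {}IHu : teval e u <= T (k + (tgn t + tgn u)) by apply: tower_max IHu; lia.
all: have := tower_ge2 (k + (tgn t + tgn u)); nia.
Qed.

Lemma meval_exact (e : nat -> nat) (d : nat -> M) k t :
  (forall i, e i <= T k) -> (forall i, d i = mnum M (e i)) -> k + tgn t <= c ->
  meval d t = mnum M (teval e t).
Proof.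
move=> ek de.
have bnd u : k + tgn u <= c -> teval e u <= n.
  by move=> le; apply: leq_trans tow; apply: tower_max (teval_tower u ek).
elim: t => [i||t IH|t IH u IHu|t IH u IHu] le; cbn [meval teval]; first exact: de.
- by [].
- by rewrite IH //; move: le; cbn [tgn]; have := cpair_ge 2 (tgn t); lia.
all: have := bnd _ le; move: le; cbn [tgn teval].
all: match goal with |- context [cpair ?a (cpair ?b ?d)] =>
  have := cpair_ge a (cpair b d); have := cpair_ge b d; set m := cpair a _ end.
all: move=> h1 h2 h3 h4; rewrite IH ?IHu; try lia.
- by rewrite (exact_add ex).
- by rewrite (exact_mul ex) //; apply: bnd; lia.
Qed.

(** The level [k] of the tower bounds the current arguments. A bounded quantifier raises it by the
    code of its bounding term; the code of the quantified formula pays for this and for the body. *)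
Lemma sat_exact f : bounded f -> forall (e : nat -> nat) (d : nat -> M) k,
  (forall i, e i <= T k) -> (forall i, d i = mnum M (e i)) -> k + fgn f <= c ->
  sat d (emb f) <-> nat_sat e f.
Proof.
have scons_ok (e : nat -> nat) (d : nat -> M) k a : a <= T k ->
    (forall i, e i <= T k) -> (forall i, d i = mnum M (e i)) ->
    (forall i, scons a e i <= T k) /\ (forall i, scons (mnum M a) d i = mnum M (scons a e i)).
  by move=> ak ek de; split; case.
have bnd (e : nat -> nat) k u : (forall i, e i <= T k) -> k + tgn u <= c -> teval e u <= n.
  by move=> ek le; apply: leq_trans tow; apply: tower_max (teval_tower u ek).
have code a b d : b + d <= cpair a (cpair b d).
  by have := cpair_ge a (cpair b d); have := cpair_ge b d; lia.
have quant (t : term) (g : La) k (e : nat -> nat) (d : nat -> M) :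
    (forall i, e i <= T k) -> (forall i, d i = mnum M (e i)) ->
    k + (tgn (tshift t) + fgn g) <= c ->
    (forall e d k, (forall i, e i <= T k) -> (forall i, d i = mnum M (e i)) ->
       k + fgn g <= c -> sat d (emb g) <-> nat_sat e g) ->
    meval d t = mnum M (teval e t) /\ teval e t <= n /\
    forall a, a <= teval e t -> sat (scons (mnum M a) d) (emb g) <-> nat_sat (scons a e) g.
  move=> ek de le IH.
  (* The code of the formula contains that of [tshift t], not of [t]; hence the detour through an
     environment with the dummy value 0 for the bound variable. *)
  have [ek0 de0] := scons_ok e d k 0 (leq0n _) ek de.
  have le1 : k + tgn (tshift t) <= c by lia.
  have ev := meval_exact ek0 de0 le1; rewrite meval_shift teval_shift in ev.
  have bd := bnd _ _ _ ek0 le1; rewrite teval_shift in bd.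
  have tw := teval_tower (tshift t) ek0; rewrite teval_shift in tw.
  split=> //; split=> // a at_.
  have km : k <= k + tgn (tshift t) by apply: leq_addr.
  have [e1 d1] := scons_ok e d (k + tgn (tshift t)) a (leq_trans at_ tw)
    (fun i => tower_max km (ek i)) de.
  by apply: (IH _ _ _ e1 d1); lia.
elim=> {f} [|t u|t u|f g _ IHf _ IHg|f g _ IHf _ IHg|f g _ IHf _ IHg|t f _ IHf|t f _ IHf]
  e d k ek de; cbn [fgn sat emb nat_sat] => le //.
1,2: move: (leq_trans (leq_add (leqnn k) (code _ _ _)) le) => {}le.
1,2: rewrite !(meval_exact ek de); try lia.
1,2: have bt : teval e t <= n by apply: bnd ek _; lia.
1,2: have bu : teval e u <= n by apply: bnd ek _; lia.
- by split=> [/(exact_inj ex bt bu)|->].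
- exact: (exact_leE ex bt bu).
1-3: move: (leq_trans (leq_add (leqnn k) (code _ _ _)) le) => {}le.
1-3: rewrite (IHf e d k) ?(IHg e d k) //; lia.
- have le' : k + (tgn (tshift t) + fgn f) <= c.
    have := cpair_ge 7 (cpair 4 (cpair (cpair 2 (cpair (cpair 0 0) (tgn (tshift t)))) (fgn f))).
    have := code 4 (cpair 2 (cpair (cpair 0 0) (tgn (tshift t)))) (fgn f).
    have := code 2 (cpair 0 0) (tgn (tshift t)); move: le; cbn [tgn]; lia.
  have [ev [bd q]] := quant t f k e d ek de le' IHf.
  cbn [meval teval scons]; split=> [h a|h x].
    rewrite teval_shift => at_; apply/q => //; apply: h; rewrite meval_shift ev.
    exact: (exact_le ex).
  (* Elements below the bound are numerals, so the quantifier in the model ranges over the same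
     numbers. *)
  rewrite meval_shift ev => /(exact_bound ex bd) [a at_ ->].
  by apply/q => //; apply: h; rewrite teval_shift.
- have le' : k + (tgn (tshift t) + fgn f) <= c.
    have := cpair_ge 8 (cpair 5 (cpair (cpair 2 (cpair (cpair 0 0) (tgn (tshift t)))) (fgn f))).
    have := code 5 (cpair 2 (cpair (cpair 0 0) (tgn (tshift t)))) (fgn f).
    have := code 2 (cpair 0 0) (tgn (tshift t)); move: le; cbn [tgn]; lia.
  have [ev [bd q]] := quant t f k e d ek de le' IHf.
  cbn [meval teval scons]; split=> -[a].
    rewrite meval_shift ev => -[/(exact_bound ex bd) [b bt ->] /(q _ bt) h].
    by exists b; rewrite teval_shift.
  rewrite teval_shift => -[at_ /(q _ at_) h].
  by exists (mnum M a); rewrite meval_shift ev; split=> //; apply: (exact_le ex).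
Qed.

End Evaluation.

(** * Models of the approximation and of R_0p *)

Record approx_at (M : model) (w : M) : Prop := {
  approx_0w : mle (mzero M) w;
  approx_le0 : forall y, mle y (mzero M) -> y = mzero M;
  approx_P : forall x, mle x w -> mP x;
  approx_refl : forall x, mle x w -> mle x x;
  approx_irr : forall x, mle x w -> ~ mle (msucc x) x;
  approx_step : forall x, mle x w -> x = w \/ mle (msucc x) w;
  approx_add0 : forall x, mle x w -> madd x (mzero M) = x;
  approx_mul0 : forall x, mle x w -> mmul x (mzero M) = mzero M;
  approx_leS : forall x y, mle x w -> mle y x -> mle y (msucc x);
  approx_leSE : forall x y, mle x w -> mle y (msucc x) -> mle y x \/ y = msucc x;
  approx_addS : forall x y, mle x w -> mle y w -> madd x (msucc y) = msucc (madd x y);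
  approx_addW : forall x y, mle x w -> mle y w -> mle (madd x (msucc y)) w -> mle (madd x y) w;
  approx_mulS : forall x y, mle x w -> mle y w -> mle (mmul x y) w ->
    mmul x (msucc y) = madd (mmul x y) x;
  approx_mulW : forall x y, mle x w -> mle y w -> mle (mmul x (msucc y)) w -> mle (mmul x y) w
}.

Lemma sat_approx (M : model) (e : nat -> M) : sat e approx <-> approx_at (e 0).
Proof.
split=> [/= [w0 [le0 h]]|h] /=.
  { split=> // x; try by move/h; tauto.
    all: move=> y /h [_ [_ [_ [_ [_ [_ /(_ y)]]]]]]; tauto. }
split; first exact: approx_0w h.
split; first exact: approx_le0 h.
move=> x xw; split; first exact: (approx_P h).
split; first exact: (approx_refl h).
split; first exact: (approx_irr h).
split; first exact: (approx_step h).
split; first exact: (approx_add0 h).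
split; first exact: (approx_mul0 h).
move=> y; split; first exact: (approx_leS h).
split; first exact: (approx_leSE h).
move=> yw; split; first exact: (approx_addS h).
split; first exact: (approx_addW h).
split; [exact: (approx_mulS h) | exact: (approx_mulW h)].
Qed.

Section Approximation.

Variables (M : model) (w : M).
Hypothesis apx : approx_at w.

Lemma approx_add n a b : (forall m, m <= n -> mle (mnum M m) w) -> a <= n -> b <= n ->
  madd (mnum M a) (mnum M b) = mnum M (a + b).
Proof.
move=> nw an; elim: b => [|b IH] bn; first by rewrite addn0; apply: approx_add0 apx _ (nw _ an).
rewrite /= (approx_addS apx) -/(mnum M b) ?IH ?addnS //;
  by [apply: nw | apply: ltnW | apply: nw; apply: ltnW].
Qed.

Lemma approx_exact n : (forall m, m <= n -> mle (mnum M m) w) -> exact_upto M n.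
Proof.
move=> nw.
have le a b : a <= b -> b <= n -> mle (mnum M a) (mnum M b).
  elim: b => [|b IH]; first by case: a => // _ _; apply: approx_refl apx _ (nw _ _).
  rewrite leq_eqVlt => /orP [/eqP-> bn|ab bn]; first exact: approx_refl apx _ (nw _ bn).
  by apply: (approx_leS apx); [apply: nw; apply: ltnW | apply: IH => //; apply: ltnW].
(* Equality would put the numeral of [b] below that of its predecessor, against [approx_irr]. *)
have neq a b : a < b -> b <= n -> mnum M a <> mnum M b.
  case: b => // b ab bn E; have bn' := ltnW bn.
  have : mle (mnum M b.+1) (mnum M b) by rewrite -E; apply: le.
  exact: approx_irr apx _ (nw _ bn').
split=> //.
- move=> a b an bn E; case: (ltngtP a b) => // [/neq/(_ bn)//|/neq/(_ an)].
  by rewrite E.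
- move=> x; elim=> [|b IH] bn; first by move/(approx_le0 apx) => ->; exists 0.
  case/(approx_leSE apx (nw _ (ltnW bn))) => [/IH|->]; last by exists b.+1.
  by case=> [|a ab ->]; [apply: ltnW | exists a => //; apply: leqW].
- by move=> a b abn; apply: approx_add nw _ _; lia.
- move=> a b an; elim: b => [|b IH] bn abn.
    by rewrite muln0; apply: approx_mul0 apx _ (nw _ an).
  have abn' : a * b <= n by nia.
  have bn' := ltnW bn.
  rewrite /= (approx_mulS apx) -/(mnum M b) ?IH ?(approx_add nw) ?mulnS //.
  - by rewrite addnC.
  - exact: nw.
  - exact: nw.
  - exact: nw.
Qed.

Section Standard.

Variable n : nat.
Hypotheses (wn : w = mnum M n) (nw : forall m, m <= n -> mle (mnum M m) w).

(** By [approx_addW] the partial sums stay below [w], so the first one to exceed [n] would be the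
    successor of [w], which by [approx_irr] is not below [w]. *)
Lemma approx_add_le a b : a <= n -> b <= n ->
  mle (madd (mnum M a) (mnum M b)) w -> a + b <= n.
Proof.
move=> an; elim: b => [|b IH] bn; first by rewrite addn0.
have bn' := ltnW bn => le.
have := approx_addW apx (nw an) (nw bn') le => /(IH bn').
rewrite leq_eqVlt => /orP [/eqP E|]; last by rewrite addnS.
have nn : mle w w by rewrite {1}wn; apply: nw.
case: (approx_irr apx nn); move: le.
by rewrite (approx_addS apx (nw an) (nw bn')) -/(mnum M b) (approx_add nw an bn') E -wn.
Qed.

(** Partial products stay below [w] by [approx_mulW], and the last step is a sum, to which
    [approx_add_le] applies. *)
Lemma approx_mul_le a b : a <= n -> b <= n ->
  mle (mmul (mnum M a) (mnum M b)) w -> a * b <= n.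
Proof.
move=> an; elim: b => [|b IH] bn; first by rewrite muln0.
have bn' := ltnW bn => le.
have lew := approx_mulW apx (nw an) (nw bn') le; have abn := IH bn' lew.
rewrite mulnS addnC; apply: approx_add_le => //; move: le.
rewrite (approx_mulS apx (nw an) (nw bn') lew) -/(mnum M b).
by rewrite (exact_mul (approx_exact nw)).
Qed.

End Standard.

End Approximation.

(** Starting from 0, [approx_step] climbs through the numerals below [w] and can stop only at [w],
    which is then standard. *)
Lemma approx_dichotomy (M : model) (w : M) : approx_at w ->
  (exists2 n, w = mnum M n & forall m, m <= n -> mle (mnum M m) w) \/
  (forall m, mle (mnum M m) w).
Proof.
move=> apx; have step m : (forall i, i < m -> w <> mnum M i) -> mle (mnum M m) w.
  elim: m => [|m IH] ne; first exact: approx_0w.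
  case: (approx_step apx (IH _)) => [i im|E|//]; first by apply: ne; apply: leqW.
  by case: (ne m (ltnSn m)).
case: (classic (forall m, mle (mnum M m) w)) => [|nall]; [by right | left].
have [m nm] := not_all_ex_not _ _ nall.
have exn : exists i, w = mnum M i.
  by apply: NNPP => ne; apply: nm; apply: step => i _ E; apply: ne; exists i.
(* The least such [n] is chosen, since the climb to a numeral presupposes that no smaller one equals
   [w]. *)
have [n wn min] : exists2 n, w = mnum M n & forall i, i < n -> w <> mnum M i.
  case: exn => i; elim/ltn_ind: i => i IH wi.
  case: (classic (exists2 j, j < i & w = mnum M j)) => [[j /IH]|nj]; first exact.
  by exists i => // j ji wj; apply: nj; exists j.
by exists n => // i le; apply: step => j ji; apply: min; apply: leq_trans le.
Qed.

Lemma sat_one_of_upto (M : model) (e : nat -> M) t n :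
  sat e (emb (one_of_upto t n)) <-> exists2 a, a <= n & meval e t = mnum M a.
Proof.
elim: n => [|n IH]; first by split=> [h|[[]]] //; exists 0.
rewrite /= IH -/(num n) meval_num; split=> [[[a an ->]|->]|[a]].
- by exists a => //; apply: leqW.
- by exists n.+1.
- rewrite leq_eqVlt => /orP [/eqP->|]; first by right.
  by move=> an E; left; exists a.
Qed.

Definition is_R0p_model (M : model) : Prop :=
  (forall n, exact_upto M n) /\ (forall n, mP (mnum M n)).

Lemma R0p_modelP (M : model) (e : nat -> M) :
  (forall g, R0p g -> sat e g) <-> is_R0p_model M.
Proof.
split=> [h|[ex mp] g].
  have R g (r : R0 g) : sat e (emb g) := h _ (R0p_R0 r).
  split=> n; last by have := h _ (R0p_P n); rewrite /= meval_num.
  split.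
  - move=> a b _ _ E; apply: NNPP => /R0_neq /R /=; apply.
    by rewrite !meval_num.
  - by move=> a b ab _; have := R _ (R0_le ab); rewrite /= !meval_num.
  - move=> x b _; have /= := R _ (R0_bound b); move/(_ x).
    by rewrite meval_num sat_one_of_upto.
  - by move=> a b _; have := R _ (R0_add a b); rewrite /= !meval_num.
  - by move=> a b _ _ _; have := R _ (R0_mul a b); rewrite /= !meval_num.
case=> [f [a b|a b|a b ne|b|a b ab]|n] /=; rewrite ?meval_num //.
- exact: (exact_add (ex _) (leqnn _)).
- by apply: (exact_mul (ex (maxn (a * b) (maxn a b)))); lia.
- by move=> E; apply: ne; apply: (exact_inj (ex (maxn a b))) E; lia.
- move=> x; rewrite meval_num sat_one_of_upto; exact: (exact_bound (ex b) (leqnn b)).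
- exact: (exact_le (ex b)).
Qed.

(** Everything below a numeral is a numeral here, so each clause becomes a fact about natural
    numbers. *)
Lemma approx_num (M : model) n : is_R0p_model M -> approx_at (mnum M n).
Proof.
move=> [ex mp].
have inj a b : mnum M a = mnum M b -> a = b.
  by apply: (exact_inj (ex (maxn a b))); lia.
have leE a b : mle (mnum M a) (mnum M b) <-> a <= b.
  by apply: (exact_leE (ex (maxn a b))); lia.
have bd x b : mle x (mnum M b) -> exists2 a, a <= b & x = mnum M a.
  exact: (exact_bound (ex b) (leqnn b)).
have addE a b : madd (mnum M a) (mnum M b) = mnum M (a + b).
  exact: (exact_add (ex _) (leqnn _)).
have mulE a b : mmul (mnum M a) (mnum M b) = mnum M (a * b).
  by apply: (exact_mul (ex (maxn (a * b) (maxn a b)))); lia.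
have E0 : mzero M = mnum M 0 by [].
have ES a : msucc (mnum M a) = mnum M a.+1 by [].
split.
- by rewrite E0; apply/leE.
- by move=> y; rewrite {1}E0 => /bd [a]; rewrite leqn0 => /eqP->.
- by move=> x /bd [a _ ->].
- by move=> x /bd [a _ ->]; apply/leE.
- by move=> x /bd [a _ ->]; rewrite ES leE ltnn.
- move=> x /bd [a an ->]; rewrite ES leE.
  by move: an; rewrite leq_eqVlt => /orP [/eqP->|]; [left | right].
- by move=> x /bd [a _ ->]; rewrite E0 addE addn0.
- by move=> x /bd [a _ ->]; rewrite E0 mulE muln0.
- by move=> x y /bd [a _ ->] /bd [b ba ->]; rewrite ES; apply/leE/leqW.
- move=> x y /bd [a _ ->]; rewrite ES => /bd [b + ->].
  by rewrite leq_eqVlt => /orP [/eqP->|ba]; [right | left; apply/leE].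
- by move=> x y /bd [a _ ->] /bd [b _ ->]; rewrite !(ES, addE) addnS.
- by move=> x y /bd [a _ ->] /bd [b _ ->]; rewrite !(ES, addE) !leE; lia.
- by move=> x y /bd [a _ ->] /bd [b _ ->] _; rewrite !(ES, mulE, addE) mulnS addnC.
- by move=> x y /bd [a _ ->] /bd [b _ ->]; rewrite !(ES, mulE) !leE; nia.
Qed.

Definition prepend (T : Type) (n : nat) (x e : nat -> T) (i : nat) : T :=
  if i < n then x i else e (i - n).

Lemma sat_iter_ex (M : model) p n (f : form p) (e : nat -> M) :
  sat e (iter n (@fex p) f) <-> exists x, sat (prepend n x e) f.
Proof.
have ext (e1 e2 : nat -> M) : e1 =1 e2 -> sat e1 f -> sat e2 f.
  by have [k cl] := fclosed_ex f => E; rewrite (sat_closed _ cl (e' := e2)).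
elim: n e => [|n IH] e.
  have E x : prepend 0 x e =1 e by move=> i; rewrite /prepend /= subn0.
  split=> [h|[x]]; last by apply: ext; apply: E.
  by exists e; apply: ext h => i; rewrite E.
rewrite /=; split=> [[a /IH [x h]]|[x h]].
  (* The outermost quantifier has index [n] in the matrix, so its witness [a] comes after those of
     the inner [n]. *)
  exists (fun i => if i < n then x i else a); apply: ext h => i.
  rewrite /prepend; case: (ltnP i n) => [lt|le]; first by rewrite leqW.
  move: le; rewrite leq_eqVlt => /orP [/eqP<-|lt]; first by rewrite subnn ltnSn.
  by rewrite ltnNge lt /= subnS; case: (i - n) (subn_gt0 n i) => [|j]; rewrite ?lt.
exists (x n); apply/IH; exists x; apply: ext h => i.
rewrite /prepend ltnS; case: (ltngtP i n) => [lt|lt|->] //; last by rewrite subnn.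
by rewrite subnS; case: (i - n) (subn_gt0 n i) => [|j]; rewrite ?lt.
Qed.

(** * Sigma_1 sentences *)

(** Makes the lemmas on [sat] available for [nat_sat]. *)
Definition nat_model : model := @Model nat 0 succn addn muln leq (fun=> True).

Lemma sat_nat_model (e : nat -> nat) (f : La) :
  sat (M := nat_model) e (emb f) <-> nat_sat e f.
Proof.
have ev e' t : meval (M := nat_model) e' t = teval e' t.
  by elim: t => //= [t ->|t -> u ->|t -> u ->].
elim: f e => //= [t u|t u|f IHf g IHg|f IHf g IHg|f IHf g IHg|f IHf|f IHf] e;
  rewrite ?ev ?IHf ?IHg //.
- by split=> h x; apply/IHf.
- by split=> -[x /IHf]; exists x.
Qed.

Lemma emb_iter_ex n (f : La) : emb (iter n (@fex false) f) = iter n (@fex true) (emb f).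
Proof. by elim: n => //= n ->. Qed.

Lemma fclosed_emb k (f : La) : fclosed k (emb f) = fclosed k f.
Proof.
by elim: f k => //= [f IHf g IHg|f IHf g IHg|f IHf g IHg] k; rewrite IHf IHg.
Qed.

Lemma fclosed_iter_ex p n k (f : form p) :
  fclosed k (iter n (@fex p) f) = fclosed (n + k) f.
Proof. by elim: n k => //= n IH k; rewrite IH addnS. Qed.

(** Stripping may run past the Sigma_1 prefix and open a bounded existential quantifier; the
    conjunction that remains is again bounded. *)
Lemma bounded_strip f : bounded f -> bounded (strip_ex f).
Proof. by case=> * /=; repeat constructor. Qed.

Lemma strip_iter_ex p m k (f : form p) : k <= m ->
  iter m (@strip_ex p) (iter k (@fex p) f) = iter (m - k) (@strip_ex p) f.
Proof.
elim: k m => [|k IH] m; first by rewrite subn0.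
by case: m => // m km; rewrite iterSr subSS; apply: IH.
Qed.

Lemma iter_ex_strip p m (f : form p) :
  exists2 j, j <= m & f = iter j (@fex p) (iter m (@strip_ex p) f).
Proof.
elim: m => [|m [j jm E]]; first by exists 0.
rewrite iterS; case E': (iter m _ f) E => [|||||||| g] E /=; try by exists j => //; apply: leqW.
by exists j.+1 => //; rewrite iterSr.
Qed.

Lemma leq_fgn_iter_ex p k (f : form p) : k + fgn f <= fgn (iter k (@fex p) f).
Proof.
elim: k => //= k IH; have := cpair_ge 8 (fgn (iter k (@fex p) f)); lia.
Qed.

(** The Goedel number is at least the length of the prefix, so all of it is stripped. Bounded
    existential quantifiers heading the matrix may go as well, so [j] can exceed the length of the
    given prefix. *)
Lemma Sigma1_matrix (s : La) : Sigma1_sentence s ->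
  let d := iter (fgn s) (@strip_ex false) s in
  exists j, [/\ j <= fgn s, s = iter j (@fex false) d, bounded d, fclosed j d
             & fgn d <= fgn s].
Proof.
move=> [cl [k [d0 [bd E]]]] /=; set d := iter _ _ _.
have [j jc Ej] := iter_ex_strip (fgn s) s; exists j; split=> //.
- have kc : k <= fgn s by rewrite E; have := leq_fgn_iter_ex k d0; lia.
  rewrite /d {2}E (strip_iter_ex _ kc); elim: (_ - _) => //= m.
  exact: bounded_strip.
- by move: cl; rewrite /sentence Ej fclosed_iter_ex addn0.
- by have := leq_fgn_iter_ex j d; rewrite /d -Ej; lia.
Qed.

Lemma tclosed_num k n : tclosed k (num n).
Proof. by elim: n. Qed.

Lemma tclosed_tower k m : tclosed m.+2 (tower k).
Proof. by elim: k => //= k ->. Qed.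

Lemma fclosed_certificate c : fclosed c (certificate c).
Proof.
have vb m : m <= c -> fclosed c.+2 (vars_below m).
  by elim: m => [|m IH] //= mc; rewrite (IH (ltnW mc)) !andbT; apply: mc.
have tb m : fclosed c.+2 (tower_below m).
  by elim: m => //= m ->; rewrite tclosed_tower.
by rewrite /certificate; cbn [fclosed]; rewrite vb // tb.
Qed.

Lemma sentence_certified s : Sigma1_sentence s -> sentence (certified s).
Proof.
move=> Ss; have [j [jc _ _ cl _]] := Sigma1_matrix Ss.
rewrite /sentence /certified; cbn [fclosed].
rewrite fclosed_iter_ex addn0 !fclosed_emb; cbn [fclosed].
by rewrite fclosed_certificate fclosed_emb (fclosed_mono jc cl) !andbT; case: Ss.
Qed.

Lemma sentence_R0p g : R0p g -> sentence g.
Proof.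
case=> [f r|n]; last by rewrite /sentence /= tclosed_num.
rewrite /sentence fclosed_emb; case: r => [a b|a b|a b ne|n|a b ab]; rewrite /= ?tclosed_num //.
by rewrite andTb; elim: n => //= n ->; rewrite tclosed_num.
Qed.

Lemma sat_vars_below (M : model) (e : nat -> M) c :
  sat e (vars_below c) <->
  [/\ mle (mnum M 1) (e 1), mle (mnum M 2) (e 1)
    & forall i, i < c -> mle (e i.+2) (e 1)].
Proof.
elim: c => [|c IH] /=; first by split=> [[]|[]].
rewrite IH; split=> [[le [h1 h2 h]]|[h1 h2 h]].
  by split=> // i; rewrite ltnS leq_eqVlt => /orP [/eqP->|/h].
by split; [apply: h | split=> // i ic; apply: h; apply: leqW].
Qed.

Lemma sat_tower_below (M : model) (e : nat -> M) c :
  sat e (tower_below c) <-> forall k, k <= c -> mle (meval e (tower k)) (e 0).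
Proof.
elim: c => [|c IH].
  by split=> [h [|]|/(_ 0)] //; apply.
cbn [tower_below sat]; rewrite IH; split=> [[le h] k|h].
  by rewrite leq_eqVlt => /orP [/eqP->|/h].
by split; [apply: h | move=> k kc; apply: h; apply: leqW].
Qed.

(** The case [m = n.+1] matters, for 1 when [n] is 0 and for 2 when [n] is 1. There the successor of
    [w] would be a numeral up to [n], hence below [w]. *)
Lemma approx_num_le (M : model) (w : M) n m a :
  approx_at w -> w = mnum M n -> (forall i, i <= n -> mle (mnum M i) w) ->
  m <= n.+1 -> a <= n -> mle (mnum M m) (mnum M a) -> m <= a.
Proof.
move=> apx wn nw mn an le; have ex := approx_exact apx nw.
move: mn; rewrite leq_eqVlt => /orP [/eqP E|mn]; last by apply/(exact_leE ex mn an).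
have [b ba Eb] := exact_bound ex an le.
suff : mle (msucc w) w.
  by move=> sw; case: (approx_irr apx _ sw); rewrite {1}wn; apply: nw.
have -> : msucc w = mnum M b by rewrite -Eb E wn.
exact: nw (leq_trans ba an).
Qed.

(** * The translation in models *)

Section Certified.

Variables (M : model) (s : La).
Hypothesis Ss : Sigma1_sentence s.

Lemma R0p_model_of_certified (e : nat -> M) :
  nat_models (fneg s) -> sat e (certified s) -> is_R0p_model M.
Proof.
move=> Ns [_ /sat_iter_ex [x]]; set c := fgn s; set d := iter c _ s.
cbn [sat]; set ex_ := prepend c x e => -[satd [z [w [/sat_approx apx [vb tb]]]]].
move/sat_vars_below: vb => /= [z1 z2 vb]; move/sat_tower_below: tb => /= tb.
rewrite /= in apx.
case: (approx_dichotomy apx) => [[n wn nw]|nw]; last first.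
  split=> n; first by apply: (approx_exact apx) => m _; apply: nw.
  exact: approx_P apx _ (nw n).
have ex := approx_exact apx nw.
have [a an za] : exists2 a, a <= n & z = mnum M a.
  by apply: (exact_bound ex) => //; rewrite -wn; apply: (tb 0).
rewrite za in z1 z2.
(* First 1 <= a, which forces n >= 1; only then is 2 within the range of [approx_num_le]. *)
have a1 : 1 <= a by apply: (approx_num_le (m := 1) apx wn nw) z1.
have a2 : 2 <= a by apply: (approx_num_le (m := 2) apx wn nw) z2 => //; lia.
(* Going up, [approx_mul_le] turns the inequality in the model into a true one, which makes the
   product exact. *)
have tow k : k <= c ->
    meval (scons w (scons z ex_)) (tower k) = mnum M (a ^ (2 ^ k)) /\ a ^ (2 ^ k) <= n.
  elim: k => [|k IH] kc; first by rewrite /= expn0 expn1.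
  have [E le] := IH (ltnW kc); have := tb _ kc; cbn [tower meval].
  rewrite E => /(approx_mul_le apx wn nw le le) le'.
  by rewrite (exact_mul ex) // expnS mul2n -addnn expnD.
(* Variables from [c] on do not occur in [d]; the value 0 keeps all arguments below [a]. *)
pose dM i := if i < c then ex_ i else mnum M 0.
have dMa i : exists b, b <= a /\ dM i = mnum M b.
  rewrite /dM; case: ifP => [/vb|_]; last by exists 0.
  by rewrite za => /(exact_bound ex an) [b ba E]; exists b.
pose b i := epsilon (inhabits 0) (fun b => b <= a /\ dM i = mnum M b).
have bP i : b i <= a /\ dM i = mnum M (b i).
  exact: (epsilon_spec (inhabits 0) (fun b => b <= a /\ dM i = mnum M b) (dMa i)).
have [j [jc Es bd cl lec]] := Sigma1_matrix Ss.
have : nat_sat b d.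
  apply/(sat_exact (z := a) (n := n) (c := c) a2 ex (proj2 (tow c (leqnn c))) bd
    (d := dM) (k := 0)) => //.
  - by move=> i; rewrite expn0 expn1; case: (bP i).
  - by move=> i; case: (bP i).
  - apply/(sat_closed (k := c) (e' := ex_)) => //; last by rewrite fclosed_emb (fclosed_mono jc).
    by move=> i ic; rewrite /dM ic.
move=> Nd; case: (Ns (fun=> 0)); apply/sat_nat_model; rewrite Es emb_iter_ex.
apply/sat_iter_ex; exists b; apply/(sat_closed (M := nat_model) (k := j) (e' := b)).
- by move=> i ij; rewrite /prepend ij.
- by rewrite fclosed_emb.
- by apply/sat_nat_model.
Qed.

Lemma certified_of_R0p_model (e : nat -> M) :
  nat_models s -> is_R0p_model M -> sat e (certified s).
Proof.
move=> Ns RM; have [ex mp] := RM; set c := fgn s.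
have [j [jc Es bd cl lec]] := Sigma1_matrix Ss.
rewrite -/c in jc Es bd cl lec; set d := iter c _ s in Es bd cl lec.
have /sat_iter_ex [x Nx] : sat (M := nat_model) (fun=> 0) (iter j (@fex true) (emb d)).
  by rewrite -emb_iter_ex -Es; apply/sat_nat_model; apply: Ns.
set b := prepend j x (fun=> 0) in Nx; move/sat_nat_model: Nx => Nb.
have [a a2 ba] : exists2 a, 2 <= a & forall i, b i <= a.
  (* The conjuncts on z require at least 2, even if all witnesses are smaller. *)
  exists (maxn 2 (\max_(i < j) x i)) => [|i]; first exact: leq_maxl.
  rewrite /b /prepend; case: ltnP => // ij; apply: leq_trans (leq_maxr _ _).
  exact: (leq_bigmax (Ordinal ij)).
(* The top of the tower itself serves as w. *)
pose n := a ^ (2 ^ c); pose dM i := mnum M (b i).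
have satd : sat dM (emb d).
  by apply/(sat_exact (z := a) (n := n) (c := c) a2 (ex n) (leqnn n) bd (e := b) (k := 0)).
have satp k : j <= k -> sat (prepend k dM e) (emb d).
  move=> jk; apply/(sat_closed (k := j) (e' := dM)) => //; last by rewrite fclosed_emb.
  by move=> i ij; rewrite /prepend (leq_trans ij jk).
rewrite /certified -/c -/d; cbn [sat]; split.
  by rewrite Es emb_iter_ex; apply/sat_iter_ex; exists dM; apply: satp.
(* The vacuous quantifiers receive 0, the value of [b] from [j] on. *)
apply/sat_iter_ex; exists dM; cbn [sat]; split; first exact: satp.
exists (mnum M a), (mnum M n); split; first by apply/sat_approx; apply: approx_num.
split.
  apply/sat_vars_below; split=> /=.
  - exact: (exact_le (ex a) (ltnW a2) (leqnn a)).
  - exact: (exact_le (ex a) a2 (leqnn a)).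
  - by move=> i ic; rewrite /prepend ic; apply: (exact_le (ex a)).
apply/sat_tower_below => k kc.
have -> m : meval (scons (mnum M n) (scons (mnum M a) (prepend c dM e))) (tower m) =
    mnum M (a ^ (2 ^ m)).
  elim: m => [|m IH]; first by rewrite /= expn0 expn1.
  cbn [tower meval]; rewrite IH expnS mul2n -addnn expnD.
  by apply: (exact_mul (ex (a ^ (2 ^ m) * a ^ (2 ^ m)))); have := tower_ge2 a2 m; nia.
exact: (exact_le (ex n) (tower_mono a2 kc) (leqnn n)).
Qed.

End Certified.

Theorem theorem5p1 :
  exists tr : La -> Lap,
    effective_on Sigma1_sentence tr /\
    forall sigma : La, Sigma1_sentence sigma ->
      [/\ sentence (tr sigma),
          proves (axiomatized_by (tr sigma)) (emb sigma),
          nat_models sigma -> proves R0p (tr sigma)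
        & nat_models (fneg sigma) -> proves_theory (axiomatized_by (tr sigma)) R0p].
Proof.
exists certified; split; first exact: certified_effective.
move=> s Ss; have cl := sentence_certified Ss; split=> //.
- exists [:: certified s]; first by move=> g /= [<-|].
  by rewrite /certified; apply: prv_andE1; apply: prv_ax; left.
- move=> Ns; apply: completeness => // [|M e /R0p_modelP]; first exact: sentence_R0p.
  exact: certified_of_R0p_model.
- move=> Ns f Rf; apply: completeness => [g ->||M e h]; [exact: cl | exact: sentence_R0p |].
  have RM := R0p_model_of_certified Ss Ns (h _ erefl).
  by move/(R0p_modelP e): RM => /(_ _ Rf).
Qed.
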